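(* Let $r$ be the ray length and $L$ the length function of the fastest saturated spiral with fire starting at the origin, at the critical construction speed. For all $\phi\ge\tan\bar\alpha+\frac\pi2-\bar\alpha$, $$r(\phi)-2.08\,L(\phi-2\pi-\bar\alpha)\ge 0.67\,e^{\bar c(\phi-\tan\bar\alpha-\frac\pi2+\bar\alpha)}.$$
   Context: $\bar\alpha\in(0,\pi/2)$ is the unique solution of $(2\pi+\bar\alpha)\cot\bar\alpha-\ln\frac{2\pi+\bar\alpha}{\sin\bar\alpha}=1$ ($\bar\alpha\approx1.1783$), the construction speed is $\bar\sigma=1/\cos\bar\alpha$, and $\bar c=\cot\bar\alpha-\frac1{2\pi+\bar\alpha}=\frac1{2\pi+\bar\alpha}\ln\frac{2\pi+\bar\alpha}{\sin\bar\alpha}$. The fire starts at the origin with unit speed; the fastest saturated spiral starts from $(1,0)$, follows the arc of the unit circle of opening $\tan\bar\alpha$, then a tangent segment of length $\cot\bar\alpha$, and then it is a spiral forming the constant angle $\bar\alpha$ with the fire rays. Its ray length $r$ is the right-continuous function with $r=1$ on $[0,\tan\bar\alpha]$, $r(\phi)=1/\cos(\phi-\tan\bar\alpha)$ on $[\tan\bar\alpha,\tan\bar\alpha+\frac\pi2-\bar\alpha]$, and, for $\phi>\tan\bar\alpha+\frac\pi2-\bar\alpha$, in the sense of distributions ($\delta_x$ Dirac mass at $x$), $$r'=\cot(\bar\alpha)r-\delta_{2\pi}-\mathbf 1_{[\frac{5\pi}2,\frac{5\pi}2+\tan\bar\alpha]}-\cot(\bar\alpha)\,\delta_{\frac{5\pi}2+\tan\bar\alpha}-\frac{r(\phi-2\pi-\bar\alpha)}{\sin\bar\alpha}\mathbf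 1_{\phi>\frac{5\pi}2+\tan\bar\alpha}.$$ $L(\phi)$ is the length of the spiral up to the rotation angle $\phi$: $L(\phi)=0$ for $\phi<0$, $L(\phi)=\phi$ on $[0,\tan\bar\alpha]$, $L(\phi)=\tan\bar\alpha+\tan(\phi-\tan\bar\alpha)$ on $[\tan\bar\alpha,\tan\bar\alpha+\frac\pi2-\bar\alpha]$, and $L(\phi)=\tan\bar\alpha+\cot\bar\alpha+\int_{\tan\bar\alpha+\frac\pi2-\bar\alpha}^{\phi}\frac{r(\psi)}{\sin\bar\alpha}\,d\psi$ for larger $\phi$. *)

(* Defs.v *)
(* Stdlib real numbers with Coquelicot. *)
From Stdlib Require Import Reals.
From Coquelicot Require Import Coquelicot.
Open Scope R_scope.

Definition cot (x : R) : R := cos x / sin x.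

(* The equation has exactly one solution in (0, PI/2); its existence and
   uniqueness are not part of the definition. *)
Definition critical_angle (alpha : R) : Prop :=
  0 < alpha < PI / 2 /\
  (2 * PI + alpha) * cot alpha - ln ((2 * PI + alpha) / sin alpha) = 1.

Definition critical_exponent (alpha : R) : R :=
  cot alpha - 1 / (2 * PI + alpha).

(* Rotation angle at which the initial tangent segment ends. *)
Definition segment_end (alpha : R) : R := tan alpha + PI / 2 - alpha.

Definition indicator_Icc (u v x : R) : R :=
  if Rle_dec u x then if Rle_dec x v then 1 else 0 else 0.

Definition indicator_Ioi (u x : R) : R := if Rlt_dec u x then 1 else 0.

Definition test_function (a b : R) (eta : R -> R) : Prop :=
  (forall (n : nat) (x : R), ex_derive_n eta n x) /\
  (forall x : R, x < a \/ b < x -> eta x = 0).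

(* The pairing of the distribution defined by [f] with a test function
   supported in [a, b]. *)
Definition pairing (a b : R) (f eta : R -> R) : R :=
  RInt (fun x => f x * eta x) a b.

(* The delay equation for the ray length, in the sense of distributions on
   the open half-line (segment_end alpha, +oo).  The left-hand side is
   <r', eta> = - <r, eta'>, and a Dirac mass at x maps eta to eta x. *)
Definition ray_equation (alpha : R) (r : R -> R) : Prop :=
  forall (a b : R) (eta : R -> R),
    segment_end alpha < a -> a < b -> test_function a b eta ->
    - pairing a b r (Derive eta) =
      cot alpha * pairing a b r eta
      - eta (2 * PI)
      - pairing a b
          (indicator_Icc (5 * PI / 2) (5 * PI / 2 + tan alpha)) eta
      - cot alpha * eta (5 * PI / 2 + tan alpha)
      - pairing a b
          (fun phi => r (phi - 2 * PI - alpha) / sin alpha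
                      * indicator_Ioi (5 * PI / 2 + tan alpha) phi) eta.

(* Only the values of [r] on [0, +oo) are constrained.  Local integrability is
   what makes [r] a distribution, as [RInt] is a total function; right
   continuity at [segment_end alpha] supplies the initial value of the
   equation. *)
Record ray_length (alpha : R) (r : R -> R) : Prop := {
  ray_right_continuous :
    forall phi : R, 0 <= phi -> filterlim r (at_right phi) (locally (r phi));
  ray_locally_integrable :
    forall a b : R, 0 <= a -> a <= b -> ex_RInt r a b;
  ray_on_arc :
    forall phi : R, 0 <= phi <= tan alpha -> r phi = 1;
  ray_on_segment :
    forall phi : R, tan alpha <= phi <= segment_end alpha ->
      r phi = 1 / cos (phi - tan alpha);
  ray_delay_equation : ray_equation alpha r
}.

Definition spiral_length (alpha : R) (r : R -> R) (phi : R) : R :=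
  if Rlt_dec phi 0 then 0
  else if Rle_dec phi (tan alpha) then phi
  else if Rle_dec phi (segment_end alpha) then
    tan alpha + tan (phi - tan alpha)
  else
    tan alpha + cot alpha
    + RInt (fun psi => r psi / sin alpha) (segment_end alpha) phi.

(* Main.v *)
Require Import Defs.
From Stdlib Require Import Reals.
From Coquelicot Require Import Coquelicot.
From Stdlib Require Import Lra Lia Psatz Machin.
Open Scope R_scope.

(** Let [T = 2 * PI + alpha] be the delay and [k = T * critical_exponent alpha].
    Measure the angle in units of [T] from the end of the initial segment and
    divide the ray by its critical growth: [rho t = r (phi0 + T * t) * exp (- k * t)].
    The critical angle is the one for which the characteristic equation has a
    double root, that is [exp (- k) = sin alpha / T] ([exp_neg_rate]), and
    therefore [rho' t = rho t - rho (t - 1)] for [t > 1] ([sigma_derive]).  With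
    [ell] the delayed length in the same scale, [ell' t = rho (t - 1) - k * ell t]
    ([ell_derive]), and the claim is [gain t = rho t - 2.08 * ell t >= 0.67] for
    all [t >= 0] ([gain_lower]).

    For large [t] this is a statement about [growth t = rho t - rho (t - 1)],
    because [gain' = - k * gain + 3.08 * growth + (k - 2.08) * rho] where [k] is
    about 2.0888: as soon as the last two terms exceed [0.67 * k], the value 0.67
    is a barrier ([gain_decay], [gain_late]).  So [growth] has to be bounded below.
    Being the derivative of [rho], [growth t] is its own mean over [t - 1, t], so
    that a lower bound on one period persists ([growth_lower_propagates]); and
    [rho t - RInt rho (t - 1) t] is a conserved quantity ([rho_drift]), which
    improves the bound 0.4433 found on [2, 3] to 0.447 on [3, +oo)
    ([growth_lower_late]).  This is enough: the limit of [growth] is about 0.4510,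
    and [gain] has its minimum, about 0.678, near [t = 3.9].

    What remains is explicit.  Between its jumps [r] solves an affine equation
    on the first period, so [rho] is a combination of exponentials there, the
    method of steps gives [rho] and [growth] on the next two periods, and on the
    first turn the length is read off from the ray ([spiral_length_first_turn]).
    All constants are rational in [PI], [alpha], its sine and cosine, and a few
    exponentials, which are enclosed by means of Taylor polynomials.

    The delay equation is given in the sense of distributions.  It is turned into
    a formula for the increments of [r] ([increment_of_distribution]) by testing
    it against smooth approximations of the indicators of intervals. *)

(** * A smooth step function *)

Definition flat (i : nat) (t : R) : R :=
  if Rlt_dec 0 t then (/ t) ^ i * exp (- / t) else 0.

Lemma flat_pos i t : 0 < t -> flat i t = (/ t) ^ i * exp (- / t).
Proof. intros; unfold flat; destruct (Rlt_dec 0 t); [reflexivity | lra]. Qed.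

Lemma flat_npos i t : t <= 0 -> flat i t = 0.
Proof. intros; unfold flat; destruct (Rlt_dec 0 t); [lra | reflexivity]. Qed.

Lemma exp_INR_mul (n : nat) (x : R) : exp (INR n * x) = exp x ^ n.
Proof.
  induction n as [|n IH]; [simpl; rewrite Rmult_0_l; apply exp_0|].
  rewrite S_INR, <- tech_pow_Rmult, <- IH, <- exp_plus; f_equal; ring.
Qed.

(** [exp (y / n) >= y / n], raised to the power [n]. *)
Lemma pow_le_exp (n : nat) (y : R) :
  0 < y -> y ^ n <= INR n ^ n * exp y.
Proof.
  intros hy; destruct n as [|n].
  - simpl; rewrite Rmult_1_l; generalize (exp_ineq1_le y); lra.
  - set (N := INR (S n)).
    assert (hN : 0 < N) by (apply lt_0_INR; lia).
    replace (exp y) with (exp (y / N) ^ S n).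
    + rewrite <- Rpow_mult_distr; apply pow_incr; split; [lra|].
      generalize (exp_ineq1_le (y / N)); intros h.
      apply Rle_trans with (N * (y / N)); [right; field; lra|].
      apply Rmult_le_compat_l; lra.
    + rewrite <- exp_INR_mul; fold N; f_equal; field; lra.
Qed.

Lemma flat_small (i : nat) : exists C, forall t, 0 < t -> Rabs (flat i t) <= C * t ^ 2.
Proof.
  exists (INR (i + 2) ^ (i + 2)); intros t ht.
  assert (hy : 0 < / t) by now apply Rinv_0_lt_compat.
  rewrite flat_pos by easy.
  generalize (pow_le_exp (i + 2) (/ t) hy); intros h.
  rewrite Rabs_pos_eq.
  2: apply Rmult_le_pos; [apply pow_le; lra | left; apply exp_pos].
  rewrite exp_Ropp; rewrite pow_add in h.
  apply Rmult_le_reg_r with (exp (/ t)); [apply exp_pos|].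
  apply Rmult_le_reg_l with ((/ t) ^ 2); [apply pow_lt; easy|].
  replace ((/ t) ^ 2 * ((/ t) ^ i * / exp (/ t) * exp (/ t))) with ((/ t) ^ i * (/ t) ^ 2)
    by (field; split; [generalize (exp_pos (/ t)); lra | lra]).
  eapply Rle_trans; [exact h|]. right. field. lra.
Qed.

(** The negative powers of [t] in front of the exponential are what makes the
    family stable under differentiation; at the origin the difference quotient
    of the [i]-th function is the next one, which vanishes there. *)
Lemma is_derive_flat (i : nat) (t : R) :
  is_derive (flat i) t (flat (i + 2) t - INR i * flat (i + 1) t).
Proof.
  destruct (Rtotal_order t 0) as [ht|[->|ht]].
  - rewrite !flat_npos by lra.
    apply is_derive_ext_loc with (fun _ => 0).
    + assert (h : 0 < - t) by lra.
      exists (mkposreal _ h); intros y hy; rewrite flat_npos; [easy|].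
      unfold ball in hy; simpl in hy; unfold AbsRing_ball, abs, minus, plus, opp in hy; simpl in hy.
      apply Rabs_def2 in hy; lra.
    + replace (0 - INR i * 0) with 0 by ring. apply @is_derive_const.
  - rewrite !flat_npos by lra; replace (0 - INR i * 0) with 0 by ring.
    destruct (flat_small i) as [C hC].
    assert (hC0 : 0 < Rabs C + 1) by (generalize (Rabs_pos C); lra).
    apply is_derive_Reals; intros eps heps.
    assert (hd : 0 < eps / (Rabs C + 1)) by (apply Rdiv_lt_0_compat; lra).
    exists (mkposreal _ hd); intros h hh0 hh; simpl in hh.
    rewrite Rplus_0_l, (flat_npos i 0), !Rminus_0_r by lra.
    destruct (Rlt_dec 0 h) as [hp|hn].
    + unfold Rdiv; rewrite Rabs_mult.
      rewrite (Rabs_pos_eq (/ h)) by (left; now apply Rinv_0_lt_compat).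
      rewrite Rabs_pos_eq in hh by lra.
      apply Rle_lt_trans with (Rabs C * h).
      * apply Rmult_le_reg_r with h; [easy|].
        rewrite Rmult_assoc, Rinv_l, Rmult_1_r by lra.
        apply Rle_trans with (1 := hC h hp).
        generalize (Rle_abs C); nra.
      * apply Rmult_lt_compat_l with (r := Rabs C + 1) in hh; [|easy].
        replace ((Rabs C + 1) * (eps / (Rabs C + 1))) with eps in hh by (field; lra).
        nra.
    + rewrite flat_npos by lra. unfold Rdiv; rewrite Rmult_0_l, Rabs_R0; easy.
  - apply is_derive_ext_loc with (fun t => (/ t) ^ i * exp (- / t)).
    + exists (mkposreal _ ht); intros y hy; rewrite flat_pos; [easy|].
      unfold ball in hy; simpl in hy; unfold AbsRing_ball, abs, minus, plus, opp in hy; simpl in hy.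
      apply Rabs_def2 in hy; lra.
    + rewrite !flat_pos by easy.
      auto_derive; [lra|].
      destruct i as [|i].
      * simpl; field; lra.
      * rewrite !pow_add; simpl pred. rewrite <- tech_pow_Rmult. simpl pow. field; lra.
Qed.

(** The derivative of a member is again a member, so that members are infinitely
    differentiable; no closed form of the higher derivatives is needed.  The last
    constructor covers integrals of bumps. *)
Inductive smooth : (R -> R) -> Prop :=
| smooth_bump (i j : nat) : smooth (fun t => flat i t * flat j (1 - t))
| smooth_comb (a b : R) (f g : R -> R) :
    smooth f -> smooth g -> smooth (fun t => a * f t + b * g t)
| smooth_affine (u v : R) (f : R -> R) :
    smooth f -> smooth (fun t => f (u * t + v))
| smooth_primitive (F f : R -> R) :
    smooth f -> (forall t, is_derive F t (f t)) -> smooth F.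

Lemma smooth_derive (f : R -> R) :
  smooth f -> exists g, smooth g /\ forall t, is_derive f t (g t).
Proof.
  induction 1 as [i j|a b f g hf [f' [hf' df]] hg [g' [hg' dg]]|u v f hf [f' [hf' df]]|F f hf _ df].
  - exists (fun t => 1 * (1 * (flat (i + 2) t * flat j (1 - t)) + (- INR i) * (flat (i + 1) t * flat j (1 - t)))
      + (-1) * (1 * (flat i t * flat (j + 2) (1 - t)) + (- INR j) * (flat i t * flat (j + 1) (1 - t)))).
    split.
    + repeat first [apply smooth_bump | apply (smooth_comb _ _ (fun t => _) (fun t => _))].
    + intros t.
      evar_last.
      * apply (is_derive_mult (flat i) (fun t => flat j (1 - t))).
        -- apply is_derive_flat.
        -- apply (is_derive_comp (flat j) (fun t => 1 - t)).
           ++ apply is_derive_flat.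
           ++ auto_derive; [easy | reflexivity].
        -- intros; apply Rmult_comm.
      * unfold plus, mult, scal; simpl; unfold mult; simpl. ring.
  - exists (fun t => a * f' t + b * g' t); split; [now apply smooth_comb|].
    intros t; apply (is_derive_plus (fun t => a * f t) (fun t => b * g t)); now apply is_derive_scal.
  - exists (fun t => u * f' (u * t + v) + 0 * f' (u * t + v)); split.
    + apply (smooth_comb _ _ (fun t => f' (u * t + v)) (fun t => f' (u * t + v))); now apply smooth_affine.
    + intros t; evar_last.
      * apply (is_derive_comp f (fun t => u * t + v)); [apply df|].
        auto_derive; [easy | reflexivity].
      * unfold scal; simpl; unfold mult; simpl; ring.
  - now exists f.
Qed.

Lemma smooth_ex_derive_n (f : R -> R) (n : nat) (t : R) :
  smooth f -> ex_derive_n f n t.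
Proof.
  intros hf.
  assert (H : forall n, exists g, smooth g /\ forall t, Derive_n f n t = g t).
  { clear n t; induction n as [|n [g [hg e]]]; [now exists f|].
    destruct (smooth_derive g hg) as [g' [hg' dg]]; exists g'; split; [easy|].
    intros t; simpl; rewrite (Derive_ext _ g t e); now apply is_derive_unique. }
  destruct n as [|n]; [exact I|].
  destruct (H n) as [g [hg e]]; destruct (smooth_derive g hg) as [g' [_ dg]].
  simpl; apply ex_derive_ext with g; [easy|]; eexists; apply dg.
Qed.

Definition bump (t : R) : R := flat 0 t * flat 0 (1 - t).

Lemma bump_nonneg t : 0 <= bump t.
Proof.
  unfold bump, flat; destruct (Rlt_dec 0 t), (Rlt_dec 0 (1 - t)); simpl; try lra.
  generalize (exp_pos (- / t)) (exp_pos (- / (1 - t))); nra.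
Qed.

Lemma bump_pos t : 0 < t < 1 -> 0 < bump t.
Proof.
  intros h; unfold bump; rewrite !flat_pos by lra; simpl.
  generalize (exp_pos (- / t)) (exp_pos (- / (1 - t))); nra.
Qed.

Lemma bump_out t : t <= 0 \/ 1 <= t -> bump t = 0.
Proof. intros [h|h]; unfold bump; [rewrite (flat_npos 0 t) | rewrite (flat_npos 0 (1 - t))]; lra. Qed.

Lemma continuous_bump t : continuous bump t.
Proof.
  apply (ex_derive_continuous bump).
  destruct (smooth_derive _ (smooth_bump 0 0)) as [g [_ hg]]; eexists; apply hg.
Qed.

Lemma ex_RInt_bump a b : ex_RInt bump a b.
Proof. apply (ex_RInt_continuous bump); intros; apply continuous_bump. Qed.

Lemma RInt_bump_pos : 0 < RInt bump 0 1.
Proof.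
  apply (RInt_gt_0 bump); [lra | apply bump_pos | intros; apply continuous_bump].
Qed.

(** Rises smoothly from 0 to 1 on the unit interval. *)
Definition step (t : R) : R := / RInt bump 0 1 * RInt bump 0 t.
Definition step' (t : R) : R := / RInt bump 0 1 * bump t.

Lemma is_derive_step t : is_derive step t (step' t).
Proof.
  apply is_derive_scal.
  apply (is_derive_RInt bump (RInt bump 0) 0 t).
  - apply filter_forall; intros y; apply (RInt_correct bump), ex_RInt_bump.
  - apply continuous_bump.
Qed.

Lemma smooth_step : smooth step.
Proof.
  apply smooth_primitive with (fun t => / RInt bump 0 1 * bump t + 0 * bump t).
  - apply (smooth_comb _ _ bump bump); apply smooth_bump.
  - intros t; replace (/ RInt bump 0 1 * bump t + 0 * bump t) with (step' t)
      by (unfold step'; lra); apply is_derive_step.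
Qed.

Lemma step'_nonneg t : 0 <= step' t.
Proof.
  apply Rmult_le_pos; [left; apply Rinv_0_lt_compat, RInt_bump_pos | apply bump_nonneg].
Qed.

Lemma step'_out t : t <= 0 \/ 1 <= t -> step' t = 0.
Proof. intros h; unfold step'; rewrite bump_out by easy; ring. Qed.

Lemma continuous_step' t : continuous step' t.
Proof. apply (continuous_scal_r (/ RInt bump 0 1) bump), continuous_bump. Qed.

Lemma step_incr x y : x <= y -> step x <= step y.
Proof.
  intros h; unfold step; apply Rmult_le_compat_l; [left; apply Rinv_0_lt_compat, RInt_bump_pos|].
  rewrite <- (RInt_Chasles bump 0 x y); try apply ex_RInt_bump.
  unfold plus; simpl.
  assert (0 <= RInt bump x y); [|lra].
  apply (RInt_ge_0 bump); [easy | apply ex_RInt_bump | intros; apply bump_nonneg].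
Qed.

Lemma RInt_zero_on (f : R -> R) a b :
  a <= b -> (forall x, a < x < b -> f x = 0) -> RInt f a b = 0.
Proof.
  intros hab hf; rewrite (RInt_ext f (fun _ => 0)).
  - rewrite RInt_const; apply Rmult_0_r.
  - rewrite Rmin_left, Rmax_right by easy; exact hf.
Qed.

Lemma step_npos t : t <= 0 -> step t = 0.
Proof.
  intros h; unfold step; rewrite <- (opp_RInt_swap bump t 0) by apply ex_RInt_bump.
  rewrite (RInt_zero_on bump t 0); [change (/ RInt bump 0 1 * - 0 = 0); ring | easy | intros; apply bump_out; lra].
Qed.

Lemma step_ge_1 t : 1 <= t -> step t = 1.
Proof.
  intros h; unfold step.
  rewrite <- (RInt_Chasles bump 0 1 t) by apply ex_RInt_bump.
  rewrite (RInt_zero_on bump 1 t); [| easy | intros; apply bump_out; lra].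
  unfold plus; simpl; field; generalize RInt_bump_pos; lra.
Qed.

Lemma step_range t : 0 <= step t <= 1.
Proof.
  split.
  - destruct (Rle_dec t 0) as [h|h]; [rewrite step_npos; lra|].
    rewrite <- (step_npos 0) by lra; apply step_incr; lra.
  - destruct (Rle_dec 1 t) as [h|h]; [rewrite step_ge_1; lra|].
    rewrite <- (step_ge_1 1) by lra; apply step_incr; lra.
Qed.

(** * Products of integrable and continuous functions *)

(** Value of [g] at the left end of the cell of the grid [a, a + d, ...] that
    contains the argument. *)
Fixpoint sampled (g : R -> R) (a d : R) (n : nat) (x : R) : R :=
  match n with
  | O => g a
  | S m => if Rle_dec x (a + INR m * d) then sampled g a d m x else g (a + INR m * d)
  end.

Lemma sampled_at (g : R -> R) (a d : R) (n : nat) (x : R) :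
  0 <= d -> a <= x <= a + INR n * d ->
  exists p, a <= p <= x /\ x - p <= d /\ sampled g a d n x = g p.
Proof.
  intros hd; induction n as [|n IH]; intros hx.
  - exists a; simpl in *; repeat split; lra.
  - rewrite S_INR in hx; simpl sampled; destruct (Rle_dec x (a + INR n * d)) as [h|h].
    + apply IH; lra.
    + exists (a + INR n * d); generalize (pos_INR n); intros; repeat split; nra.
Qed.

Lemma ex_RInt_mult_sampled (f g : R -> R) (a d : R) (n : nat) :
  0 <= d -> ex_RInt f a (a + INR n * d) ->
  ex_RInt (fun x => f x * sampled g a d n x) a (a + INR n * d).
Proof.
  intros hd; induction n as [|n IH]; intros hf.
  - simpl; rewrite Rmult_0_l, Rplus_0_r; apply ex_RInt_point.
  - assert (hn := pos_INR n).
    assert (h1 : a <= a + INR n * d <= a + INR (S n) * d) by (rewrite S_INR; nra).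
    apply ex_RInt_Chasles with (a + INR n * d).
    + apply ex_RInt_ext with (fun x => f x * sampled g a d n x).
      * rewrite Rmin_left, Rmax_right by lra; intros x hx; simpl sampled.
        destruct (Rle_dec x (a + INR n * d)); [easy | lra].
      * apply IH; now apply (ex_RInt_Chasles_1 f) with (2 := hf).
    + apply ex_RInt_ext with (fun x => scal (g (a + INR n * d)) (f x)).
      * rewrite Rmin_left, Rmax_right by lra; intros x hx; simpl sampled.
        destruct (Rle_dec x (a + INR n * d)); [lra|]. unfold scal; simpl; unfold mult; simpl; ring.
      * apply (ex_RInt_scal f); now apply (ex_RInt_Chasles_2 f) with (2 := hf).
Qed.

(** Needed because [pairing] is meaningful only for integrable products.  The
    products with the sampled values of [g] are integrable piece by piece and
    converge uniformly. *)
Lemma ex_RInt_mult_continuous (f g : R -> R) (a b : R) :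
  a <= b -> ex_RInt f a b -> (forall x, continuous g x) ->
  ex_RInt (fun x => f x * g x) a b.
Proof.
  intros hab hf hg.
  destruct (ex_RInt_ub f a b hf) as [M hM].
  rewrite Rmin_left, Rmax_right in hM by easy.
  assert (hM0 : 0 <= M).
  { apply Rle_trans with (2 := hM a (conj (Rle_refl a) hab)), norm_ge_0. }
  set (d := fun n : nat => (b - a) / INR (S n)).
  assert (hd0 : forall n, 0 <= d n).
  { intros n; apply Rdiv_le_0_compat; [lra | apply lt_0_INR; lia]. }
  assert (hdn : forall n, a + INR (S n) * d n = b).
  { intros n; unfold d; field; apply not_0_INR; lia. }
  set (cut := fun (h : R -> R) x => if Rle_dec a x then if Rle_dec x b then h x else 0 else 0).
  assert (hcut : forall h x, a <= x <= b -> cut h x = h x).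
  { intros h x hx; unfold cut; destruct (Rle_dec a x), (Rle_dec x b); lra. }
  set (F := fun n => cut (fun x => f x * sampled g a (d n) (S n) x)).
  set (G := cut (fun x => f x * g x)).
  assert (hF : forall n, ex_RInt (F n) a b).
  { intros n; apply ex_RInt_ext with (fun x => f x * sampled g a (d n) (S n) x).
    - rewrite Rmin_left, Rmax_right by easy; intros x hx; unfold F; rewrite hcut; [easy | lra].
    - rewrite <- (hdn n); apply ex_RInt_mult_sampled; [easy | now rewrite hdn]. }
  destruct (filterlim_RInt F a b eventually _ G (fun n => RInt (F n) a b)) as [I [_ hI]].
  - intros n; apply (RInt_correct (F n)), hF.
  - apply filterlim_locally; intros eps.
    assert (he : 0 < eps / (M + 1)) by (apply Rdiv_lt_0_compat; [apply cond_pos | lra]).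
    destruct (unifcont_normed_1d g a b (fun x _ => hg x) (mkposreal _ he)) as [delta hdelta].
    assert (hlim : is_lim_seq d 0).
    { unfold d; replace (Finite 0) with (Rbar_mult (b - a) 0) by (simpl; f_equal; ring).
      apply is_lim_seq_scal_l.
      apply (is_lim_seq_inv (fun n => INR (S n)) p_infty); [|easy].
      apply -> is_lim_seq_incr_1; apply is_lim_seq_INR. }
    apply is_lim_seq_spec in hlim; destruct (hlim delta) as [N hN].
    exists N; intros n hn x; unfold F, G.
    change (Rabs (cut (fun y => f y * sampled g a (d n) (S n) y) x - cut (fun y => f y * g y) x) < eps).
    unfold cut; destruct (Rle_dec a x) as [h1|]; [destruct (Rle_dec x b) as [h2|]|].
    2, 3 : rewrite Rminus_0_r, Rabs_R0; apply cond_pos.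
    destruct (sampled_at g a (d n) (S n) x (hd0 n)) as [p [hp [hpx ->]]]; [rewrite hdn; lra|].
    specialize (hN n hn); rewrite Rminus_0_r, Rabs_pos_eq in hN by easy.
    assert (hgp : Rabs (g p - g x) < eps / (M + 1)).
    { apply (hdelta x p); [lra | lra |].
      change (Rabs (p - x) < delta); rewrite Rabs_left1; lra. }
    rewrite <- Rmult_minus_distr_l, Rabs_mult.
    apply Rle_lt_trans with (M * Rabs (g p - g x)).
    + apply Rmult_le_compat_r; [apply Rabs_pos | apply (hM x); lra].
    + apply Rle_lt_trans with (M * (eps / (M + 1))).
      * apply Rmult_le_compat_l; lra.
      * apply Rmult_lt_reg_r with (M + 1); [lra|].
        replace (M * (eps / (M + 1)) * (M + 1)) with (M * eps) by (field; lra).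
        generalize (cond_pos eps); nra.
  - exists I; apply is_RInt_ext with (2 := hI).
    rewrite Rmin_left, Rmax_right by easy; intros x hx; unfold G; rewrite hcut; [easy | lra].
Qed.

(** * From the distributional equation to increments *)

(** Tends to the Dirac mass at [z], from the right. *)
Definition kernel (z e t : R) : R := step' ((t - z) / e) / e.

(** Tends to the indicator of (x, y]. *)
Definition plateau (x y e t : R) : R := step ((t - x) / e) - step ((t - y) / e).

Lemma is_derive_rescaled_step z e t :
  0 < e -> is_derive (fun t => step ((t - z) / e)) t (kernel z e t).
Proof.
  intros he; evar_last.
  - apply (is_derive_comp step (fun t => (t - z) / e)); [apply is_derive_step|].
    auto_derive; [easy | reflexivity].
  - unfold kernel, scal; simpl; unfold mult; simpl; field; lra.
Qed.

Lemma is_derive_plateau x y e t :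
  0 < e -> is_derive (plateau x y e) t (kernel x e t - kernel y e t).
Proof.
  intros he.
  apply (is_derive_minus (fun t => step ((t - x) / e)) (fun t => step ((t - y) / e)));
    now apply is_derive_rescaled_step.
Qed.

Lemma continuous_kernel z e t : continuous (kernel z e) t.
Proof.
  apply (continuous_mult (fun t => step' ((t - z) / e)) (fun _ => / e)); [|apply continuous_const].
  apply (continuous_comp (fun t => (t - z) / e) step'); [|apply continuous_step'].
  apply (ex_derive_continuous (fun t => (t - z) / e)); auto_derive; easy.
Qed.

Lemma kernel_nonneg z e t : 0 < e -> 0 <= kernel z e t.
Proof.
  intros he; apply Rmult_le_pos; [apply step'_nonneg | left; now apply Rinv_0_lt_compat].
Qed.

Lemma kernel_out z e t : 0 < e -> t <= z \/ z + e <= t -> kernel z e t = 0.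
Proof.
  intros he h; unfold kernel; rewrite step'_out; [field; lra|].
  destruct h as [h|h]; [left | right].
  - apply Rmult_le_reg_r with e; [easy|]; unfold Rdiv; rewrite Rmult_assoc, Rinv_l; lra.
  - apply Rmult_le_reg_r with e; [easy|]; unfold Rdiv; rewrite Rmult_assoc, Rinv_l; lra.
Qed.

Lemma is_RInt_kernel z e : 0 < e -> is_RInt (kernel z e) z (z + e) 1.
Proof.
  intros he; evar_last.
  - apply (is_RInt_derive (fun t => step ((t - z) / e)) (kernel z e)).
    + intros; now apply is_derive_rescaled_step.
    + intros; apply continuous_kernel.
  - change (step ((z + e - z) / e) - step ((z - z) / e) = 1).
    rewrite step_ge_1, step_npos; [ring | |]; right; field; lra.
Qed.

Lemma step_before z e t : 0 < e -> t <= z -> step ((t - z) / e) = 0.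
Proof.
  intros he h; apply step_npos.
  apply Rmult_le_reg_r with e; [easy|]; unfold Rdiv; rewrite Rmult_assoc, Rinv_l; lra.
Qed.

Lemma step_after z e t : 0 < e -> z + e <= t -> step ((t - z) / e) = 1.
Proof.
  intros he h; apply step_ge_1.
  apply Rmult_le_reg_r with e; [easy|]; unfold Rdiv; rewrite Rmult_assoc, Rinv_l; lra.
Qed.

Lemma plateau_range x y e t : 0 < e -> x <= y -> Rabs (plateau x y e t) <= 1.
Proof.
  intros he hxy; unfold plateau.
  generalize (step_range ((t - x) / e)) (step_range ((t - y) / e)); intros.
  apply Rabs_le; lra.
Qed.

Lemma test_function_plateau x y e :
  0 < e -> x <= y -> test_function x (y + e) (plateau x y e).
Proof.
  intros he hxy; split.
  - intros n t.
    apply ex_derive_n_ext with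
      (fun t => 1 * step (/ e * t + - x / e) + (-1) * step (/ e * t + - y / e)).
    + intros s; unfold plateau.
      replace (/ e * s + - x / e) with ((s - x) / e) by (field; lra).
      replace (/ e * s + - y / e) with ((s - y) / e) by (field; lra). ring.
    + apply smooth_ex_derive_n.
      apply (smooth_comb _ _ (fun t => step (/ e * t + - x / e)) (fun t => step (/ e * t + - y / e)));
        apply smooth_affine, smooth_step.
  - intros t [ht|ht]; unfold plateau.
    + rewrite !step_before; lra.
    + rewrite !step_after; lra.
Qed.

(** 1 when [p] lies in (x, y], which is the increment over (x, y] of the
    right-continuous unit step at [p]. *)
Definition crossed (x y p : R) : R :=
  if Rlt_dec x p then if Rle_dec p y then 1 else 0 else 0.

Lemma plateau_at x y p :
  x < y ->
  exists d, 0 < d /\ forall e, 0 < e < d -> plateau x y e p = crossed x y p.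
Proof.
  intros hxy; unfold crossed, plateau.
  destruct (Rlt_dec x p) as [h1|h1]; [destruct (Rle_dec p y) as [h2|h2]|].
  - exists (p - x); split; [lra|]; intros e he.
    rewrite step_after, step_before; lra.
  - exists (p - y); split; [lra|]; intros e he.
    rewrite !step_after; lra.
  - exists 1; split; [lra|]; intros e he.
    rewrite !step_before; lra.
Qed.

Lemma RInt_split (f : R -> R) a b c :
  a <= b <= c -> ex_RInt f a c -> RInt f a c = RInt f a b + RInt f b c.
Proof.
  intros h hf; symmetry; apply (RInt_Chasles f).
  - now apply (ex_RInt_Chasles_1 f) with (2 := hf).
  - now apply (ex_RInt_Chasles_2 f) with (2 := hf).
Qed.

Lemma RInt_mult_kernel_close (r : R -> R) z e v d :
  0 < e -> ex_RInt r z (z + e) ->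
  (forall t, z < t < z + e -> Rabs (r t - v) <= d) ->
  Rabs (RInt (fun t => r t * kernel z e t) z (z + e) - v) <= d.
Proof.
  intros he hr hd.
  assert (hk := is_RInt_kernel z e he).
  assert (hi : ex_RInt (fun t => r t * kernel z e t) z (z + e)).
  { apply ex_RInt_mult_continuous; [lra | easy | intros; apply continuous_kernel]. }
  assert (hc : forall u, is_RInt (fun t => u * kernel z e t) z (z + e) u).
  { intros u; evar_last; [exact (is_RInt_scal (kernel z e) z (z + e) u 1 hk) | apply Rmult_1_r]. }
  assert (H : forall t, z < t < z + e ->
      (v - d) * kernel z e t <= r t * kernel z e t <= (v + d) * kernel z e t).
  { intros t ht; specialize (hd t ht); apply Rabs_le_between in hd.
    assert (hn := kernel_nonneg z e t he); nra. }
  apply Rabs_le; split.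
  - assert (v - d <= RInt (fun t => r t * kernel z e t) z (z + e)); [|lra].
    rewrite <- (is_RInt_unique _ _ _ _ (hc (v - d))).
    apply RInt_le; [lra | eexists; apply hc | easy | apply H].
  - assert (RInt (fun t => r t * kernel z e t) z (z + e) <= v + d); [|lra].
    rewrite <- (is_RInt_unique _ _ _ _ (hc (v + d))).
    apply RInt_le; [lra | easy | eexists; apply hc | apply H].
Qed.

Lemma RInt_mult_kernel_restrict (r : R -> R) z e a b :
  0 < e -> a <= z -> z + e <= b -> ex_RInt r a b ->
  RInt (fun t => r t * kernel z e t) a b = RInt (fun t => r t * kernel z e t) z (z + e).
Proof.
  intros he ha hb hr.
  assert (hi : ex_RInt (fun t => r t * kernel z e t) a b).
  { apply ex_RInt_mult_continuous; [lra | easy | intros; apply continuous_kernel]. }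
  rewrite (RInt_split _ a z b) by (lra || easy).
  rewrite (RInt_split _ z (z + e) b); [|lra|].
  - rewrite (RInt_zero_on _ a z), (RInt_zero_on _ (z + e) b); try lra.
    + intros t ht; rewrite kernel_out; lra.
    + intros t ht; rewrite kernel_out; lra.
  - apply (ex_RInt_Chasles_2 (fun t => r t * kernel z e t)) with a; [lra | easy].
Qed.

(** The plateau differs from the indicator of [x, y] only on two intervals of
    length [e]. *)
Lemma RInt_mult_plateau_close (F : R -> R) x y e M :
  0 < e < y - x -> ex_RInt F x (y + e) ->
  (forall t, x <= t <= y + e -> Rabs (F t) <= M) ->
  Rabs (RInt (fun t => F t * plateau x y e t) x (y + e) - RInt F x y) <= 3 * (e * M).
Proof.
  intros he hF hM.
  assert (hi : ex_RInt (fun t => F t * plateau x y e t) x (y + e)).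
  { apply ex_RInt_mult_continuous; [lra | easy |]; intros t.
    apply (ex_derive_continuous (plateau x y e)); eexists; now apply is_derive_plateau. }
  assert (hb : forall t, x <= t <= y + e -> Rabs (F t * plateau x y e t) <= M).
  { intros t ht; rewrite Rabs_mult.
    assert (h1 := hM t ht); assert (h2 := plateau_range x y e t (proj1 he) ltac:(lra)).
    generalize (Rabs_pos (F t)) (Rabs_pos (plateau x y e t)); nra. }
  assert (sub : forall (f : R -> R) a b, x <= a <= b -> b <= y + e ->
      ex_RInt f x (y + e) -> ex_RInt f a b).
  { intros f a b h1 h2 h; apply (ex_RInt_Chasles_1 f) with (y + e); [lra|].
    apply (ex_RInt_Chasles_2 f) with x; [lra | easy]. }
  rewrite (RInt_split _ x (x + e) (y + e)) by (lra || easy).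
  rewrite (RInt_split _ (x + e) y (y + e)); [|lra | apply sub; lra || easy].
  rewrite (RInt_split F x (x + e) y); [|lra | apply sub; lra || easy].
  rewrite (RInt_ext (fun t => F t * plateau x y e t) F (x + e) y).
  2: { rewrite Rmin_left, Rmax_right by lra; intros t ht; unfold plateau.
       rewrite step_after, step_before; lra. }
  assert (b1 : Rabs (RInt (fun t => F t * plateau x y e t) x (x + e)) <= (x + e - x) * M).
  { apply abs_RInt_le_const; [lra | apply sub; lra || easy | intros t ht; apply hb; lra]. }
  assert (b2 : Rabs (RInt (fun t => F t * plateau x y e t) y (y + e)) <= (y + e - y) * M).
  { apply abs_RInt_le_const; [lra | apply sub; lra || easy | intros t ht; apply hb; lra]. }
  assert (b3 : Rabs (RInt F x (x + e)) <= (x + e - x) * M).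
  { apply abs_RInt_le_const; [lra | apply sub; lra || easy | intros t ht; apply hM; lra]. }
  apply Rabs_le_between in b1; apply Rabs_le_between in b2; apply Rabs_le_between in b3.
  apply Rabs_le; lra.
Qed.

Lemma right_continuous_close (r : R -> R) x d :
  0 < d -> filterlim r (at_right x) (locally (r x)) ->
  exists e, 0 < e /\ forall t, x < t < x + e -> Rabs (r t - r x) <= d.
Proof.
  intros hd h; destruct (proj1 (filterlim_locally r (r x)) h (mkposreal d hd)) as [e he].
  exists e; split; [apply cond_pos|]; intros t ht; left.
  apply (he t); [|lra].
  change (Rabs (t - x) < e); rewrite Rabs_pos_eq; lra.
Qed.

Lemma smaller_positive a b : 0 < a -> 0 < b -> exists c, 0 < c /\ c <= a /\ c <= b.
Proof.
  intros ha hb; exists (Rmin a b); repeat split;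
    [now apply Rmin_pos | apply Rmin_l | apply Rmin_r].
Qed.

(** Testing against smoothed indicators of [x, y] and letting the smoothing
    width tend to 0: the left-hand side tends to the increment of [r] because
    [r] is right-continuous, and each Dirac mass in (x, y] is counted once. *)
Lemma increment_of_distribution (r F : R -> R) (l p q m n : R) :
  (forall x, l < x -> filterlim r (at_right x) (locally (r x))) ->
  (forall a b, l < a -> a <= b -> ex_RInt r a b) ->
  (forall a b, l < a -> a <= b -> ex_RInt F a b) ->
  (forall a b eta, l < a -> a < b -> test_function a b eta ->
    - pairing a b r (Derive eta) = pairing a b F eta - m * eta p - n * eta q) ->
  forall x y, l < x -> x < y ->
    r y - r x = RInt F x y - m * crossed x y p - n * crossed x y q.
Proof.
  intros hright hr hF heq x y hlx hxy.
  destruct (ex_RInt_ub F x (y + 1) (hF x (y + 1) hlx ltac:(lra))) as [M hM].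
  rewrite Rmin_left, Rmax_right in hM by lra.
  assert (hM0 : 0 <= M) by (apply Rle_trans with (2 := hM x ltac:(lra)), norm_ge_0).
  destruct (plateau_at x y p hxy) as [dp [hdp Hp]].
  destruct (plateau_at x y q hxy) as [dq [hdq Hq]].
  apply Req_lt_aux; intros eps.
  assert (he4 : 0 < eps / 4) by (generalize (cond_pos eps); lra).
  destruct (right_continuous_close r x _ he4 (hright x hlx)) as [e1 [he1 H1]].
  destruct (right_continuous_close r y _ he4 (hright y ltac:(lra))) as [e2 [he2 H2]].
  set (d := eps / (12 * (M + 1))).
  assert (hd : 0 < d) by (apply Rdiv_lt_0_compat; [apply cond_pos | lra]).
  destruct (smaller_positive dp dq hdp hdq) as [c1 [? []]].
  destruct (smaller_positive e1 e2 he1 he2) as [c2 [? []]].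
  destruct (smaller_positive d (y - x) hd ltac:(lra)) as [c3 [? []]].
  destruct (smaller_positive c1 c2) as [c4 [? []]]; try easy.
  destruct (smaller_positive c3 1) as [c5 [? []]]; try lra.
  destruct (smaller_positive c4 c5) as [c6 [? []]]; try easy.
  set (e := c6 / 2); assert (he : 0 < e /\ e < c6) by (unfold e; lra).
  assert (hrI : ex_RInt r x (y + e)) by (apply hr; lra).
  assert (hFI : ex_RInt F x (y + e)) by (apply hF; lra).
  assert (E := heq x (y + e) (plateau x y e) hlx ltac:(lra)
                 (test_function_plateau x y e ltac:(lra) ltac:(lra))).
  rewrite Hp, Hq in E by lra.
  assert (B0 := RInt_mult_plateau_close F x y e M ltac:(lra) hFI
                  ltac:(intros t ht; apply (hM t); lra)).
  fold (pairing x (y + e) F (plateau x y e)) in B0.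
  assert (sub : forall z, x <= z <= y -> ex_RInt r z (z + e)).
  { intros z hz; apply hr; lra. }
  assert (B1 := RInt_mult_kernel_close r x e (r x) _ (proj1 he) (sub x ltac:(lra))
                  ltac:(intros t ht; apply H1; lra)).
  assert (B2 := RInt_mult_kernel_close r y e (r y) _ (proj1 he) (sub y ltac:(lra))
                  ltac:(intros t ht; apply H2; lra)).
  assert (EL : pairing x (y + e) r (Derive (plateau x y e))
      = RInt (fun t => r t * kernel x e t) x (x + e) - RInt (fun t => r t * kernel y e t) y (y + e)).
  { rewrite <- (RInt_mult_kernel_restrict r x e x (y + e)) by (lra || easy).
    rewrite <- (RInt_mult_kernel_restrict r y e x (y + e)) by (lra || easy).
    unfold pairing.
    rewrite (RInt_ext _ (fun t => r t * kernel x e t - r t * kernel y e t)).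
    - apply (RInt_minus (fun t => r t * kernel x e t) (fun t => r t * kernel y e t));
        (apply ex_RInt_mult_continuous; [lra | easy | intros; apply continuous_kernel]).
    - intros t _; rewrite (is_derive_unique _ _ _ (is_derive_plateau x y e t (proj1 he))).
      apply Rmult_minus_distr_l. }
  assert (heM : e * M < eps / 12).
  { apply Rle_lt_trans with (e * (M + 1)); [nra|].
    apply Rlt_le_trans with (d * (M + 1)); [apply Rmult_lt_compat_r; lra|].
    unfold d; right; field; lra. }
  apply Rabs_le_between in B0; apply Rabs_le_between in B1; apply Rabs_le_between in B2.
  apply Rabs_def1; lra.
Qed.

(** * Numerical enclosures *)

(** The Taylor polynomial of degree 13, in Horner form. *)
Definition exp_taylor (y : R) : R :=
  1 + y * (1 + y / 2 * (1 + y / 3 * (1 + y / 4 * (1 + y / 5 * (1 + y / 6 * (1 + y / 7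
    * (1 + y / 8 * (1 + y / 9 * (1 + y / 10 * (1 + y / 11 * (1 + y / 12 * (1 + y / 13)))))))))))).

(** In the Lagrange remainder the exponential at the intermediate point lies
    between 0 and [exp y]; 87178291200 is the factorial of 14. *)
Lemma exp_taylor_bounds (y : R) : 0 < y ->
  exp_taylor y <= exp y /\ exp y * (1 - y ^ 14 / 87178291200) <= exp_taylor y.
Proof.
  intros hy.
  assert (D : forall n x, Derive_n exp n x = exp x).
  { induction n as [|n IH]; intros x; [easy|]; simpl; rewrite (Derive_ext _ exp) by apply IH.
    apply is_derive_unique, is_derive_exp. }
  destruct (Taylor_Lagrange exp 13 0 y hy) as [z [hz e]].
  { intros t _ k _; destruct k as [|k]; [exact I|]; simpl.
    apply ex_derive_ext with exp; [intros; now rewrite D | eexists; apply is_derive_exp]. }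
  rewrite D in e.
  rewrite (sum_eq _ (fun m => y ^ m / INR (Factorial.fact m))) in e.
  2: { intros i _; rewrite D, exp_0, Rminus_0_r; ring. }
  assert (E : sum_f_R0 (fun m => y ^ m / INR (Factorial.fact m)) 13 = exp_taylor y).
  { unfold exp_taylor; cbn [sum_f_R0].
    repeat rewrite fact_simpl, mult_INR; rewrite !S_INR; simpl INR; field. }
  rewrite E, Rminus_0_r in e.
  replace (INR (Factorial.fact 14)) with 87178291200 in e.
  2: { repeat rewrite fact_simpl, mult_INR; rewrite !S_INR; simpl INR; ring. }
  assert (h1 := exp_pos z); assert (h2 : exp z < exp y) by (apply exp_increasing; lra).
  assert (h3 : 0 < y ^ 14) by now apply pow_lt.
  split; nra.
Qed.

Lemma exp_enclosure (x a b l u : R) :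
  0 < a -> a <= x <= b -> l <= exp_taylor a -> b ^ 14 < 87178291200 ->
  exp_taylor b <= u * (1 - b ^ 14 / 87178291200) -> l <= exp x <= u.
Proof.
  intros ha hx hl hb hu.
  destruct (exp_taylor_bounds a ha) as [h1 _].
  destruct (exp_taylor_bounds b ltac:(lra)) as [_ h2].
  split.
  - apply Rle_trans with (exp a); [lra|]; destruct (proj1 hx) as [h|<-]; [|lra].
    left; now apply exp_increasing.
  - apply Rle_trans with (exp b).
    + destruct (proj2 hx) as [h|<-]; [|lra]; left; now apply exp_increasing.
    + apply Rmult_le_reg_r with (1 - b ^ 14 / 87178291200); lra.
Qed.

Ltac exp_enclosed a b :=
  apply (exp_enclosure _ a b); [lra | lra | unfold exp_taylor; lra | lra | unfold exp_taylor; lra].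

Lemma mult_enclosure {a b c d x y : R} :
  a <= x <= b -> c <= y <= d -> 0 <= a -> 0 <= c -> a * c <= x * y <= b * d.
Proof. intros; split; nra. Qed.

Lemma inv_enclosure {a b x : R} : a <= x <= b -> 0 < a -> / b <= / x <= / a.
Proof. intros h ha; split; apply Rinv_le_contravar; lra. Qed.

Lemma div_enclosure {a b c d x y : R} :
  a <= x <= b -> c <= y <= d -> 0 <= a -> 0 < c -> a / d <= x / y <= b / c.
Proof.
  intros hx hy ha hc; apply mult_enclosure; [easy | now apply inv_enclosure | easy |].
  left; apply Rinv_0_lt_compat; lra.
Qed.

Lemma PI_enclosure : 3.141592653 <= PI <= 3.141592654.
Proof.
  assert (H := PI_2_3_7_ineq 4).
  unfold PI_2_3_7_tg, tg_alt, Ratan_seq in H; cbn [sum_f_R0 Nat.mul Nat.add] in H.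
  rewrite !INR_IZR_INZ in H.
  repeat match type of H with context [IZR ?a] =>
    let b := eval vm_compute in a in progress change a with b in H end.
  simpl in H; lra.
Qed.

Ltac compute_approx :=
  unfold sin_approx, sin_term, cos_approx, cos_term; cbn [sum_f_R0 Nat.mul Nat.add];
  repeat rewrite fact_simpl, mult_INR; rewrite ?S_INR; simpl INR.

Lemma sin_lo : 0.92395824 <= sin 1.178303 <= 0.92395826.
Proof.
  generalize (pre_sin_bound 1.178303 2 ltac:(lra) ltac:(lra)).
  compute_approx. intros; lra.
Qed.

Lemma sin_hi : 0.923959 <= sin 1.178305 <= 0.92395902.
Proof.
  generalize (pre_sin_bound 1.178305 2 ltac:(lra) ltac:(lra)).
  compute_approx. intros; lra.
Qed.

Lemma cos_lo : 0.3824933 <= cos 1.178303 <= 0.38249335.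
Proof.
  generalize (pre_cos_bound 1.178303 2 ltac:(lra) ltac:(lra)).
  compute_approx. intros; lra.
Qed.

Lemma cos_hi : 0.38249145 <= cos 1.178305 <= 0.3824915.
Proof.
  generalize (pre_cos_bound 1.178305 2 ltac:(lra) ltac:(lra)).
  compute_approx. intros; lra.
Qed.

(** ** The critical angle *)

Definition angle_defect (x : R) : R :=
  (2 * PI + x) * cot x - ln ((2 * PI + x) / sin x) - 1.

Lemma is_derive_angle_defect (x : R) :
  0 < x < PI / 2 ->
  is_derive angle_defect x (2 * cot x - / (2 * PI + x) - (2 * PI + x) / sin x ^ 2).
Proof.
  intros hx; assert (hpi := PI_enclosure).
  assert (hs : 0 < sin x) by (apply sin_gt_0; lra).
  assert (h2 := sin2_cos2 x); unfold Rsqr in h2.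
  unfold angle_defect, cot; auto_derive.
  - repeat split; try lra; apply Rmult_lt_0_compat; [lra | now apply Rinv_0_lt_compat].
  - replace (cos x * cos x) with (1 - sin x * sin x) by lra.
    apply Rminus_diag_uniq.
    transitivity ((2 * PI + x) * (1 - (sin x * sin x + cos x * cos x)) / sin x ^ 2).
    + field; lra.
    + rewrite h2; field; lra.
Qed.

Lemma angle_defect_decreasing (x y : R) :
  0 < x -> x < y -> y < PI / 2 -> angle_defect y < angle_defect x.
Proof.
  intros hx hxy hy; assert (hpi := PI_enclosure).
  destruct (MVT_gen angle_defect x y
    (fun x => 2 * cot x - / (2 * PI + x) - (2 * PI + x) / sin x ^ 2)) as [z [hz e]].
  - rewrite Rmin_left, Rmax_right by lra; intros; apply is_derive_angle_defect; lra.
  - rewrite Rmin_left, Rmax_right by lra; intros z hz.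
    apply continuity_pt_filterlim, (ex_derive_continuous angle_defect).
    eexists; apply is_derive_angle_defect; lra.
  - rewrite Rmin_left, Rmax_right in hz by lra.
    assert (hs : 0 < sin z) by (apply sin_gt_0; lra).
    assert (h1 : sin z * cos z <= 1).
    { generalize (SIN_bound z) (COS_bound z); nra. }
    assert (h2 : 2 * cot z - / (2 * PI + z) - (2 * PI + z) / sin z ^ 2 < 0); [|nra].
    assert (h3 : 0 < / (2 * PI + z)) by (apply Rinv_0_lt_compat; lra).
    assert (h4 : 2 * cot z - (2 * PI + z) / sin z ^ 2
                 = (2 * (sin z * cos z) - (2 * PI + z)) * / sin z ^ 2).
    { unfold cot; field; lra. }
    assert (h5 : 0 < / sin z ^ 2) by (apply Rinv_0_lt_compat, pow_lt; easy).
    nra.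
Qed.

(** The defect is decreasing and changes sign in the window. *)
Lemma critical_angle_enclosure (alpha : R) :
  critical_angle alpha -> 1.178303 <= alpha <= 1.178305.
Proof.
  intros [[h0 h1] h]; assert (hpi := PI_enclosure).
  assert (hd : angle_defect alpha = 0) by (unfold angle_defect; lra).
  split; apply Rnot_lt_le; intros hlt.
  - assert (H := angle_defect_decreasing alpha 1.178303 h0 hlt ltac:(lra)).
    assert (hs := sin_lo); assert (hc := cos_lo).
    rewrite hd in H; unfold angle_defect, cot in H.
    assert (hT : 7.461488306 <= 2 * PI + 1.178303 <= 7.461488308) by lra.
    assert (hk := mult_enclosure hT (div_enclosure hc hs ltac:(lra) ltac:(lra)) ltac:(lra) ltac:(lra)).
    assert (hq := div_enclosure hT hs ltac:(lra) ltac:(lra)).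
    assert (he : 8.0756 <= exp ((2 * PI + 1.178303) * (cos 1.178303 / sin 1.178303) - 1) <= 9).
    { exp_enclosed 2.08885 2.0889. }
    assert (hl : ln ((2 * PI + 1.178303) / sin 1.178303)
      < (2 * PI + 1.178303) * (cos 1.178303 / sin 1.178303) - 1); [|lra].
    rewrite <- (ln_exp (_ - 1)); apply ln_increasing; lra.
  - assert (H := angle_defect_decreasing 1.178305 alpha ltac:(lra) hlt ltac:(lra)).
    assert (hs := sin_hi); assert (hc := cos_hi).
    rewrite hd in H; unfold angle_defect, cot in H.
    assert (hT : 7.461490306 <= 2 * PI + 1.178305 <= 7.461490308) by lra.
    assert (hk := mult_enclosure hT (div_enclosure hc hs ltac:(lra) ltac:(lra)) ltac:(lra) ltac:(lra)).
    assert (hq := div_enclosure hT hs ltac:(lra) ltac:(lra)).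
    assert (he : 8 <= exp ((2 * PI + 1.178305) * (cos 1.178305 / sin 1.178305) - 1) <= 8.07552).
    { exp_enclosed 2.0888 2.088835. }
    assert (hl : (2 * PI + 1.178305) * (cos 1.178305 / sin 1.178305) - 1
      < ln ((2 * PI + 1.178305) / sin 1.178305)); [|lra].
    rewrite <- (ln_exp (_ - 1)) at 1; apply ln_increasing; [apply exp_pos | lra].
Qed.

Lemma exp_lower2 z : 0 <= z -> 1 + z + z * z / 2 <= exp z.
Proof.
  intros hz; generalize (exp_ge_taylor z 2 hz); simpl; lra.
Qed.

(** ** Constants of the first three periods *)

Definition period (alpha : R) : R := 2 * PI + alpha.

(** Equal to [critical_exponent alpha * period alpha]. *)
Definition rate (alpha : R) : R := period alpha * cot alpha - 1.

(** The angles [2 * PI], where the ray jumps, and [5 * PI / 2], where it starts to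
    meet the arc, in the time scale of [rho]. *)
Definition t_jump (alpha : R) : R := (2 * PI - segment_end alpha) / period alpha.
Definition t_arc (alpha : R) : R := (5 * PI / 2 - segment_end alpha) / period alpha.

(** [amp0], [amp1], [amp2] are the coefficients of [exp t] in [rho] on
    [0, t_jump), [t_jump, t_arc] and [t_arc, 1). *)
Definition amp0 (alpha : R) : R := / sin alpha.
Definition amp1 (alpha : R) : R :=
  amp0 alpha - exp (- (rate alpha * t_jump alpha)) / exp (t_jump alpha).
Definition amp2 (alpha : R) : R :=
  amp1 alpha - tan alpha * (exp (- (rate alpha * t_arc alpha)) / exp (t_arc alpha)).

(** [lev0], [lev1], [lev2] are the values of [exp (- x) * rho (1 + x)] at
    [x = 0], [t_jump], [t_arc]. *)
Definition lev0 (alpha : R) : R :=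
  exp 1 * amp2 alpha + tan alpha * exp (- rate alpha) - cot alpha * exp (- rate alpha).
Definition lev1 (alpha : R) : R := lev0 alpha - amp0 alpha * t_jump alpha.
Definition lev2 (alpha : R) : R := lev1 alpha - amp1 alpha * (t_arc alpha - t_jump alpha).
Definition rho2 (alpha : R) : R :=
  exp 1 * (lev2 alpha - amp2 alpha * (1 - t_arc alpha))
  - tan alpha / (rate alpha + 1)
    * (exp 1 * (exp (- (rate alpha * t_arc alpha)) / exp (t_arc alpha)) - exp (- rate alpha)).

(** The value of [rho t - RInt rho (t - 1) t], the same for all [t >= 1]. *)
Definition drift (alpha : R) : R :=
  amp0 alpha - exp (- (rate alpha * t_jump alpha))
  - period alpha * (exp (- (rate alpha * t_arc alpha)) - exp (- rate alpha)) / rate alpha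
  - cot alpha * exp (- rate alpha).

(** [growth1] and [growth2] are the values of [exp (- x) * (rho (2 + x) - rho (1 + x))]
    at [x = t_jump] and [t_arc]. *)
Definition growth1 (alpha : R) : R :=
  rho2 alpha - lev0 alpha - (lev0 alpha - amp0 alpha) * t_jump alpha
  + amp0 alpha * (t_jump alpha * t_jump alpha) / 2.
Definition growth2 (alpha : R) : R :=
  growth1 alpha - (lev1 alpha - amp1 alpha) * (t_arc alpha - t_jump alpha)
  + amp1 alpha * ((t_arc alpha - t_jump alpha) * (t_arc alpha - t_jump alpha)) / 2.

Section Enclosures.

Context (alpha : R) (halpha : critical_angle alpha).

(** The exponential form of the equation that defines the critical angle: it
    normalises the coefficient of the delayed term to 1. *)
Lemma exp_neg_rate : exp (- rate alpha) = sin alpha / period alpha.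
Proof.
  destruct halpha as [[h0 h1] h]; assert (hpi := PI_enclosure).
  assert (hs : 0 < sin alpha) by (apply sin_gt_0; lra).
  replace (rate alpha) with (ln (period alpha / sin alpha)) by (unfold rate, period in *; lra).
  rewrite exp_Ropp, exp_ln.
  - field; unfold period; lra.
  - apply Rdiv_lt_0_compat; unfold period; lra.
Qed.

(** The enclosures below follow from this one by monotonicity, each from the
    preceding ones; the width 2e-6 grows to about 2e-4 for the last constants. *)
Lemma alpha_enclosure : 1.178303 <= alpha <= 1.178305.
Proof. now apply critical_angle_enclosure. Qed.

Lemma sin_enclosure : 0.92395823 <= sin alpha <= 0.92395903.
Proof.
  assert (ha := alpha_enclosure); assert (hpi := PI_enclosure).
  split.
  - apply Rle_trans with (sin 1.178303); [generalize sin_lo; lra | apply sin_incr_1; lra].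
  - apply Rle_trans with (sin 1.178305); [apply sin_incr_1; lra | generalize sin_hi; lra].
Qed.

Lemma cos_enclosure : 0.38249144 <= cos alpha <= 0.38249336.
Proof.
  assert (ha := alpha_enclosure); assert (hpi := PI_enclosure).
  split.
  - apply Rle_trans with (cos 1.178305); [generalize cos_hi; lra | apply cos_decr_1; lra].
  - apply Rle_trans with (cos 1.178303); [apply cos_decr_1; lra | generalize cos_lo; lra].
Qed.

Lemma cot_enclosure : 0.41397013 <= cot alpha <= 0.41397257.
Proof.
  generalize (div_enclosure cos_enclosure sin_enclosure ltac:(lra) ltac:(lra)); unfold cot; lra.
Qed.

Lemma tan_enclosure : 2.415619 <= tan alpha <= 2.41563323.
Proof.
  generalize (div_enclosure sin_enclosure cos_enclosure ltac:(lra) ltac:(lra)); unfold tan; lra.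
Qed.

Lemma period_enclosure : 7.4614883 <= period alpha <= 7.46149031.
Proof.
  generalize alpha_enclosure PI_enclosure; unfold period; lra.
Qed.

Lemma rate_enclosure : 2.08883328 <= rate alpha <= 2.08885232.
Proof.
  generalize (mult_enclosure period_enclosure cot_enclosure ltac:(lra) ltac:(lra)); unfold rate; lra.
Qed.

Lemma amp0_enclosure : 1.08229907 <= amp0 alpha <= 1.08230001.
Proof.
  generalize (inv_enclosure sin_enclosure ltac:(lra)); unfold amp0; lra.
Qed.

Lemma segment_end_enclosure : 2.80811032 <= segment_end alpha <= 2.80812656.
Proof.
  generalize tan_enclosure alpha_enclosure PI_enclosure; unfold segment_end; lra.
Qed.

Lemma t_jump_enclosure : 0.46573252 <= t_jump alpha <= 0.46573484.
Proof.
  assert (h : 3.47505874 <= 2 * PI - segment_end alpha <= 3.47507499)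
    by (generalize segment_end_enclosure PI_enclosure; lra).
  generalize (div_enclosure h period_enclosure ltac:(lra) ltac:(lra)); unfold t_jump; lra.
Qed.

Lemma t_arc_enclosure : 0.67625298 <= t_arc alpha <= 0.67625535.
Proof.
  assert (h : 5.04585507 <= 5 * PI / 2 - segment_end alpha <= 5.04587132)
    by (generalize segment_end_enclosure PI_enclosure; lra).
  generalize (div_enclosure h period_enclosure ltac:(lra) ltac:(lra)); unfold t_arc; lra.
Qed.

Lemma exp_t_jump_enclosure : 1.59318079 <= exp (t_jump alpha) <= 1.5931845.
Proof.
  assert (h := t_jump_enclosure); exp_enclosed 0.46573252 0.46573484.
Qed.

Lemma exp_t_arc_enclosure : 1.96649541 <= exp (t_arc alpha) <= 1.96650008.
Proof.
  assert (h := t_arc_enclosure); exp_enclosed 0.67625298 0.67625535.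
Qed.

Lemma decay_jump_enclosure : 0.37800369 <= exp (- (rate alpha * t_jump alpha)) <= 0.37800889.
Proof.
  assert (h := mult_enclosure rate_enclosure t_jump_enclosure ltac:(lra) ltac:(lra)).
  assert (he : 2.64544046 <= exp (rate alpha * t_jump alpha) <= 2.6454768)
    by exp_enclosed 0.97283758 0.97285131.
  rewrite exp_Ropp; generalize (inv_enclosure he ltac:(lra)); lra.
Qed.

Lemma decay_arc_enclosure : 0.24350992 <= exp (- (rate alpha * t_arc alpha)) <= 0.24351428.
Proof.
  assert (h := mult_enclosure rate_enclosure t_arc_enclosure ltac:(lra) ltac:(lra)).
  assert (he : 4.1065355 <= exp (rate alpha * t_arc alpha) <= 4.10660873)
    by exp_enclosed 1.41257973 1.41259756.
  rewrite exp_Ropp; generalize (inv_enclosure he ltac:(lra)); lra.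
Qed.

Lemma decay_one_enclosure : 0.12383025 <= exp (- rate alpha) <= 0.1238304.
Proof.
  rewrite exp_neg_rate; generalize (div_enclosure sin_enclosure period_enclosure ltac:(lra) ltac:(lra)); lra.
Qed.

Lemma exp_1_enclosure : 2.71828181 <= exp 1 <= 2.71828184.
Proof.
  exp_enclosed 1 1.
Qed.

Lemma amp1_enclosure : 0.84503228 <= amp1 alpha <= 0.84503704.
Proof.
  assert (h := amp0_enclosure).
  generalize (div_enclosure decay_jump_enclosure exp_t_jump_enclosure ltac:(lra) ltac:(lra)); unfold amp1; lra.
Qed.

Lemma decay_arc_ratio_enclosure : 0.12382909 <= exp (- (rate alpha * t_arc alpha)) / exp (t_arc alpha) <= 0.12383161.
Proof.
  generalize (div_enclosure decay_arc_enclosure exp_t_arc_enclosure ltac:(lra) ltac:(lra)); lra.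
Qed.

Lemma amp2_enclosure : 0.54590052 <= amp2 alpha <= 0.54591314.
Proof.
  assert (h := amp1_enclosure).
  generalize (mult_enclosure tan_enclosure decay_arc_ratio_enclosure ltac:(lra) ltac:(lra)); unfold amp2; lra.
Qed.

Lemma lev0_enclosure : 1.73177576 <= lev0 alpha <= 1.73181258.
Proof.
  assert (h0 := mult_enclosure exp_1_enclosure amp2_enclosure ltac:(lra) ltac:(lra)).
  assert (h1 := mult_enclosure tan_enclosure decay_one_enclosure ltac:(lra) ltac:(lra)).
  assert (h2 := mult_enclosure cot_enclosure decay_one_enclosure ltac:(lra) ltac:(lra)).
  unfold lev0; lra.
Qed.

Lemma drift_enclosure : 0.2255062 <= drift alpha <= 0.22553292.
Proof.
  assert (h0 : 0.11967951 <= exp (- (rate alpha * t_arc alpha)) - exp (- rate alpha) <= 0.11968404)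
    by (generalize decay_arc_enclosure decay_one_enclosure; lra).
  assert (h1 := mult_enclosure period_enclosure h0 ltac:(lra) ltac:(lra)).
  assert (h2 := div_enclosure h1 rate_enclosure ltac:(lra) ltac:(lra)).
  assert (h3 := mult_enclosure cot_enclosure decay_one_enclosure ltac:(lra) ltac:(lra)).
  generalize amp0_enclosure decay_jump_enclosure; unfold drift; lra.
Qed.

Lemma lev1_enclosure : 1.22771093 <= lev1 alpha <= 1.22775071.
Proof.
  assert (h0 := mult_enclosure amp0_enclosure t_jump_enclosure ltac:(lra) ltac:(lra)).
  generalize lev0_enclosure; unfold lev1; lra.
Qed.

Lemma gap_enclosure : 0.21051813 <= t_arc alpha - t_jump alpha <= 0.21052284.
Proof.
  generalize t_jump_enclosure t_arc_enclosure; lra.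
Qed.

Lemma lev2_enclosure : 1.04981133 <= lev2 alpha <= 1.0498561.
Proof.
  assert (h0 := mult_enclosure amp1_enclosure gap_enclosure ltac:(lra) ltac:(lra)).
  generalize lev1_enclosure; unfold lev2; lra.
Qed.

Lemma rho2_enclosure : 2.20685544 <= rho2 alpha <= 2.20699934.
Proof.
  assert (h0 : 0.32374464 <= 1 - t_arc alpha <= 0.32374703) by (generalize t_arc_enclosure; lra).
  assert (h1 := mult_enclosure amp2_enclosure h0 ltac:(lra) ltac:(lra)).
  assert (h2 : 0.87307357 <= lev2 alpha - amp2 alpha * (1 - t_arc alpha) <= 0.87312374)
    by (generalize lev2_enclosure; lra).
  assert (h3 := mult_enclosure exp_1_enclosure h2 ltac:(lra) ltac:(lra)).
  assert (h4 : 3.08883327 <= rate alpha + 1 <= 3.08885233) by (generalize rate_enclosure; lra).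
  assert (h5 := div_enclosure tan_enclosure h4 ltac:(lra) ltac:(lra)).
  assert (h6 := mult_enclosure exp_1_enclosure decay_arc_ratio_enclosure ltac:(lra) ltac:(lra)).
  assert (h7 : 0.21277196 <= exp 1 * (exp (- (rate alpha * t_arc alpha)) / exp (t_arc alpha))
                - exp (- rate alpha) <= 0.21277897)
    by (generalize decay_one_enclosure; lra).
  assert (h8 := mult_enclosure h5 h7 ltac:(lra) ltac:(lra)).
  unfold rho2; lra.
Qed.

Lemma slope2_enclosure : 0.47504285 <= rho2 alpha - lev0 alpha <= 0.47522359.
Proof.
  generalize rho2_enclosure lev0_enclosure; lra.
Qed.

Lemma growth_slope0_enclosure : 0.64947574 <= lev0 alpha - amp0 alpha <= 0.64951352.
Proof.
  generalize lev0_enclosure amp0_enclosure; lra.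
Qed.

Lemma growth_slope1_enclosure : 0.38267388 <= lev1 alpha - amp1 alpha <= 0.38271844.
Proof.
  generalize lev1_enclosure amp1_enclosure; lra.
Qed.

Lemma growth1_enclosure : 0.28992077 <= growth1 alpha <= 0.2901219.
Proof.
  assert (h0 := mult_enclosure growth_slope0_enclosure t_jump_enclosure ltac:(lra) ltac:(lra)).
  assert (h1 := mult_enclosure t_jump_enclosure t_jump_enclosure ltac:(lra) ltac:(lra)).
  assert (h2 := mult_enclosure amp0_enclosure h1 ltac:(lra) ltac:(lra)).
  generalize slope2_enclosure; unfold growth1; lra.
Qed.

Lemma growth2_enclosure : 0.22807481 <= growth2 alpha <= 0.22828808.
Proof.
  assert (h0 := mult_enclosure growth_slope1_enclosure gap_enclosure ltac:(lra) ltac:(lra)).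
  assert (h1 := mult_enclosure gap_enclosure gap_enclosure ltac:(lra) ltac:(lra)).
  assert (h2 := mult_enclosure amp1_enclosure h1 ltac:(lra) ltac:(lra)).
  generalize growth1_enclosure; unfold growth2; lra.
Qed.

Lemma tan_decay_arc_enclosure : 0.2991239 <= tan alpha * (exp (- (rate alpha * t_arc alpha)) / exp (t_arc alpha)) <= 0.29913176.
Proof.
  generalize (mult_enclosure tan_enclosure decay_arc_ratio_enclosure ltac:(lra) ltac:(lra)); lra.
Qed.

End Enclosures.

(** * Comparison of solutions of linear equations *)

Lemma le_of_derive_nonneg (f df : R -> R) (a b : R) :
  a <= b ->
  (forall x, a < x < b -> is_derive f x (df x)) ->
  (forall x, a <= x <= b -> continuous f x) ->
  (forall x, a < x < b -> 0 <= df x) -> f a <= f b.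
Proof.
  intros hab hd hc hp.
  (* The mean value point may be an end point, where [df] says nothing. *)
  set (df' := fun x => if Rlt_dec a x then if Rlt_dec x b then df x else 0 else 0).
  destruct (MVT_gen f a b df') as [c [_ e]].
  - rewrite Rmin_left, Rmax_right by easy; intros x hx.
    unfold df'; destruct (Rlt_dec a x), (Rlt_dec x b); try lra; now apply hd.
  - rewrite Rmin_left, Rmax_right by easy; intros x hx.
    now apply continuity_pt_filterlim, hc.
  - assert (0 <= df' c); [|nra].
    unfold df'; destruct (Rlt_dec a c), (Rlt_dec c b); try lra; now apply hp.
Qed.

(** The integrating factor [exp (- m * x)] makes the difference monotone. *)
Lemma linear_comparison (m : R) (f df g dg : R -> R) (a b : R) :
  a <= b ->
  (forall x, a < x < b -> is_derive f x (df x)) ->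
  (forall x, a < x < b -> is_derive g x (dg x)) ->
  (forall x, a <= x <= b -> continuous f x) ->
  (forall x, a <= x <= b -> continuous g x) ->
  (forall x, a < x < b -> dg x - m * g x <= df x - m * f x) ->
  g a <= f a -> g b <= f b.
Proof.
  intros hab hf hg cf cg hle ha.
  set (E := fun x => exp (- (m * x))).
  assert (dE : forall x, is_derive E x (- m * E x)).
  { intros x; unfold E; auto_derive; [easy | ring]. }
  assert (H : (f a - g a) * E a <= (f b - g b) * E b).
  { apply (le_of_derive_nonneg (fun x => (f x - g x) * E x)
      (fun x => (df x - dg x) * E x + (f x - g x) * (- m * E x))); [easy | | |].
    - intros x hx.
      apply (is_derive_mult (fun x => f x - g x) E); [| apply dE | intros; apply Rmult_comm].
      apply (is_derive_minus f g); auto.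
    - intros x hx; apply (continuous_mult (fun x => f x - g x) E).
      + apply (continuous_minus f g); auto.
      + apply (ex_derive_continuous E); eexists; apply dE.
    - intros x hx; assert (hE : 0 < E x) by apply exp_pos.
      specialize (hle x hx); nra. }
  assert (hEa : 0 < E a) by apply exp_pos; assert (hEb : 0 < E b) by apply exp_pos.
  assert (0 <= (f a - g a) * E a) by nra.
  nra.
Qed.

Lemma linear_uniqueness (m : R) (f df g dg : R -> R) (a b : R) :
  a <= b ->
  (forall x, a < x < b -> is_derive f x (df x)) ->
  (forall x, a < x < b -> is_derive g x (dg x)) ->
  (forall x, a <= x <= b -> continuous f x) ->
  (forall x, a <= x <= b -> continuous g x) ->
  (forall x, a < x < b -> df x - m * f x = dg x - m * g x) ->
  f a = g a -> f b = g b.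
Proof.
  intros hab hf hg cf cg h ha; apply Rle_antisym.
  - apply (linear_comparison m g dg f df a b); auto; [intros; rewrite h; lra | lra].
  - apply (linear_comparison m f df g dg a b); auto; [intros; rewrite h; lra | lra].
Qed.

Lemma exp_neg_upper2 z : 0 <= z -> exp (- z) <= 1 - z + z ^ 2 / 2.
Proof.
  intros hz; set (f := fun z => 1 - z + z ^ 2 / 2 - exp (- z)).
  assert (H : f 0 <= f z).
  { apply (le_of_derive_nonneg f (fun z => -1 + z + exp (- z))); [easy | | |].
    - intros x _; unfold f; auto_derive; [easy | field].
    - intros x _; apply (ex_derive_continuous f); unfold f; auto_derive; easy.
    - intros x hx; generalize (exp_ineq1_le (- x)); lra. }
  unfold f in H; rewrite Ropp_0, exp_0 in H; lra.
Qed.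

Lemma exp_neg_lower3 z : 0 <= z -> 1 - z + z ^ 2 / 2 - z ^ 3 / 6 <= exp (- z).
Proof.
  intros hz; set (f := fun z => exp (- z) - (1 - z + z ^ 2 / 2 - z ^ 3 / 6)).
  assert (H : f 0 <= f z).
  { apply (le_of_derive_nonneg f (fun z => - exp (- z) + 1 - z + z ^ 2 / 2)); [easy | | |].
    - intros x _; unfold f; auto_derive; [easy | field].
    - intros x _; apply (ex_derive_continuous f); unfold f; auto_derive; easy.
    - intros x hx; generalize (exp_neg_upper2 x ltac:(lra)); lra. }
  unfold f in H; rewrite Ropp_0, exp_0 in H; lra.
Qed.

Lemma exp_neg_upper4 z : 0 <= z -> exp (- z) <= 1 - z + z ^ 2 / 2 - z ^ 3 / 6 + z ^ 4 / 24.
Proof.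
  intros hz; set (f := fun z => 1 - z + z ^ 2 / 2 - z ^ 3 / 6 + z ^ 4 / 24 - exp (- z)).
  assert (H : f 0 <= f z).
  { apply (le_of_derive_nonneg f (fun z => -1 + z - z ^ 2 / 2 + z ^ 3 / 6 + exp (- z))); [easy | | |].
    - intros x _; unfold f; auto_derive; [easy | field].
    - intros x _; apply (ex_derive_continuous f); unfold f; auto_derive; easy.
    - intros x hx; generalize (exp_neg_lower3 x ltac:(lra)); lra. }
  unfold f in H; rewrite Ropp_0, exp_0 in H; lra.
Qed.

Lemma locally_above (b x : R) (P : R -> Prop) :
  b < x -> (forall y, b < y -> P y) -> locally x P.
Proof.
  intros hx hP; assert (h : 0 < x - b) by lra.
  exists (mkposreal _ h); intros y hy; apply hP.
  change (Rabs (y - x) < x - b) in hy; apply Rabs_def2 in hy; lra.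
Qed.

Lemma continuous_primitive (f : R -> R) (a b x : R) :
  b < x -> (forall y, b < y -> ex_RInt f a y) -> continuous (fun y => RInt f a y) x.
Proof.
  intros hx hf; apply (continuous_RInt_1 f a x), (locally_above b); [easy|].
  intros y hy; now apply (RInt_correct f), hf.
Qed.

Lemma is_derive_primitive (f : R -> R) (a b x : R) :
  b < x -> (forall y, b < y -> ex_RInt f a y) -> continuous f x ->
  is_derive (fun y => RInt f a y) x (f x).
Proof.
  intros hx hf hc; apply (is_derive_RInt f _ a x), hc; apply (locally_above b); [easy|].
  intros y hy; now apply (RInt_correct f), hf.
Qed.

Lemma locally_between (a b x : R) (P : R -> Prop) :
  a < x < b -> (forall y, a < y < b -> P y) -> locally x P.
Proof.
  intros hx hP; assert (h : 0 < Rmin (x - a) (b - x)) by (apply Rmin_pos; lra).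
  exists (mkposreal _ h); intros y hy; apply hP.
  change (Rabs (y - x) < Rmin (x - a) (b - x)) in hy; apply Rabs_def2 in hy.
  generalize (Rmin_l (x - a) (b - x)) (Rmin_r (x - a) (b - x)); lra.
Qed.

(** * The ray length as a solution of an integral equation *)

Section Ray.

Context (alpha : R) (r : R -> R) (halpha : critical_angle alpha) (hr : ray_length alpha r).

Notation T := (period alpha).
Notation k := (rate alpha).
Notation phi0 := (segment_end alpha).
Notation phi1 := (5 * PI / 2 + tan alpha).

Lemma angle_order : 0 < phi0 /\ phi0 < 2 * PI /\ 2 * PI < 5 * PI / 2 /\ 5 * PI / 2 < phi1.
Proof.
  generalize (segment_end_enclosure alpha halpha) PI_enclosure (tan_enclosure alpha halpha); lra.
Qed.

Lemma phi1_eq : phi1 = phi0 + T.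
Proof. unfold segment_end, period; lra. Qed.

Definition ray_delayed (phi : R) : R :=
  r (phi - 2 * PI - alpha) / sin alpha * indicator_Ioi phi1 phi.

Definition ray_slope (phi : R) : R :=
  cot alpha * r phi - indicator_Icc (5 * PI / 2) phi1 phi - ray_delayed phi.

Lemma ex_RInt_mixed (f : R -> R) :
  (forall a b, 0 <= a -> a <= b -> ex_RInt f a b) ->
  forall a b, 0 <= a -> 0 <= b -> ex_RInt f a b.
Proof.
  intros h a b ha hb; destruct (Rle_dec a b); [now apply h|].
  apply ex_RInt_swap, h; lra.
Qed.

Lemma ex_RInt_ray a b : 0 <= a -> 0 <= b -> ex_RInt r a b.
Proof. apply ex_RInt_mixed, (ray_locally_integrable _ _ hr). Qed.

Lemma ex_RInt_pieces (f : R -> R) (p : R) :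
  0 <= p ->
  (forall a b, 0 <= a -> a <= b -> b <= p -> ex_RInt f a b) ->
  (forall a b, p <= a -> a <= b -> ex_RInt f a b) ->
  forall a b, 0 <= a -> a <= b -> ex_RInt f a b.
Proof.
  intros hp h1 h2 a b ha hab.
  destruct (Rle_dec b p); [apply h1; lra|].
  destruct (Rle_dec p a); [apply h2; lra|].
  apply ex_RInt_Chasles with p; [apply h1 | apply h2]; lra.
Qed.

Lemma ex_RInt_indicator_Icc u v a b :
  0 <= u -> u <= v -> 0 <= a -> 0 <= b -> ex_RInt (indicator_Icc u v) a b.
Proof.
  intros hu huv; revert a b; apply ex_RInt_mixed, (ex_RInt_pieces _ v); [lra | |].
  - intros a b ha hab hb; destruct (Rle_dec b u) as [h|h]; [|destruct (Rle_dec a u) as [h'|h']].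
    + apply ex_RInt_ext with (fun _ => 0); [|apply ex_RInt_const].
      rewrite Rmin_left, Rmax_right by easy; intros x hx; unfold indicator_Icc.
      destruct (Rle_dec u x); [lra | easy].
    + apply ex_RInt_Chasles with u.
      * apply ex_RInt_ext with (fun _ => 0); [|apply ex_RInt_const].
        rewrite Rmin_left, Rmax_right by easy; intros x hx; unfold indicator_Icc.
        destruct (Rle_dec u x); [lra | easy].
      * apply ex_RInt_ext with (fun _ => 1); [|apply ex_RInt_const].
        rewrite Rmin_left, Rmax_right by lra; intros x hx; unfold indicator_Icc.
        destruct (Rle_dec u x), (Rle_dec x v); lra.
    + apply ex_RInt_ext with (fun _ => 1); [|apply ex_RInt_const].
      rewrite Rmin_left, Rmax_right by easy; intros x hx; unfold indicator_Icc.
      destruct (Rle_dec u x), (Rle_dec x v); lra.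
  - intros a b ha hab; apply ex_RInt_ext with (fun _ => 0); [|apply ex_RInt_const].
    rewrite Rmin_left, Rmax_right by easy; intros x hx; unfold indicator_Icc.
    destruct (Rle_dec u x), (Rle_dec x v); lra.
Qed.

Lemma ray_delayed_zero phi : phi <= phi1 -> ray_delayed phi = 0.
Proof.
  intros h; unfold ray_delayed, indicator_Ioi; destruct (Rlt_dec phi1 phi); [lra | ring].
Qed.

Lemma ray_delayed_after phi : phi1 < phi -> ray_delayed phi = r (phi - T) / sin alpha.
Proof.
  intros h; unfold ray_delayed, indicator_Ioi; destruct (Rlt_dec phi1 phi); [|lra].
  unfold period; rewrite Rmult_1_r; do 2 f_equal; ring.
Qed.

Lemma ex_RInt_ray_delayed a b : 0 <= a -> 0 <= b -> ex_RInt ray_delayed a b.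
Proof.
  assert (o := angle_order); assert (e1 := phi1_eq).
  revert a b; apply ex_RInt_mixed, (ex_RInt_pieces _ phi1); [lra | |].
  - intros a b _ hab hb; apply ex_RInt_ext with (fun _ => 0); [|apply ex_RInt_const].
    rewrite Rmin_left, Rmax_right by easy; intros x hx; symmetry; apply ray_delayed_zero; lra.
  - intros a b ha hab.
    apply ex_RInt_ext with (fun x => scal (/ sin alpha) (scal 1 (r (1 * x + - T)))).
    + rewrite Rmin_left, Rmax_right by easy; intros x hx; rewrite ray_delayed_after by lra.
      unfold scal; simpl; unfold mult; simpl.
      rewrite !Rmult_1_l; apply Rmult_comm.
    + apply (ex_RInt_scal (fun x => scal 1 (r (1 * x + - T)))), (ex_RInt_comp_lin r).
      apply ex_RInt_ray; lra.
Qed.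

Lemma ex_RInt_ray_slope a b : 0 <= a -> 0 <= b -> ex_RInt ray_slope a b.
Proof.
  intros ha hb; assert (o := angle_order).
  apply (ex_RInt_minus (fun x => cot alpha * r x - indicator_Icc (5 * PI / 2) phi1 x) ray_delayed).
  - apply (ex_RInt_minus (fun x => cot alpha * r x) (indicator_Icc (5 * PI / 2) phi1)).
    + apply (ex_RInt_scal r); now apply ex_RInt_ray.
    + apply ex_RInt_indicator_Icc; lra.
  - now apply ex_RInt_ray_delayed.
Qed.

Lemma pairing_ray_slope a b eta :
  0 <= a -> a <= b -> (forall x, continuous eta x) ->
  pairing a b ray_slope eta =
    cot alpha * pairing a b r eta
    - pairing a b (indicator_Icc (5 * PI / 2) phi1) eta
    - pairing a b ray_delayed eta.
Proof.
  intros ha hab hc; assert (o := angle_order).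
  assert (hm : forall f, ex_RInt f a b -> ex_RInt (fun x => f x * eta x) a b).
  { intros f hf; now apply ex_RInt_mult_continuous. }
  assert (h1 : ex_RInt (fun x => r x * eta x) a b) by (apply hm, ex_RInt_ray; lra).
  assert (h2 : ex_RInt (fun x => indicator_Icc (5 * PI / 2) phi1 x * eta x) a b)
    by (apply hm, ex_RInt_indicator_Icc; lra).
  assert (h3 : ex_RInt (fun x => ray_delayed x * eta x) a b) by (apply hm, ex_RInt_ray_delayed; lra).
  apply (is_RInt_unique (fun x => ray_slope x * eta x)).
  apply is_RInt_ext with (fun x => minus (minus (scal (cot alpha) (r x * eta x))
    (indicator_Icc (5 * PI / 2) phi1 x * eta x)) (ray_delayed x * eta x)).
  - intros x _; unfold ray_slope.
    change (cot alpha * (r x * eta x) - indicator_Icc (5 * PI / 2) phi1 x * eta x - ray_delayed x * eta x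
      = (cot alpha * r x - indicator_Icc (5 * PI / 2) phi1 x - ray_delayed x) * eta x).
    ring.
  - apply (is_RInt_minus (V := R_NormedModule)); [apply (is_RInt_minus (V := R_NormedModule))|].
    + apply (is_RInt_scal (V := R_NormedModule)), (RInt_correct (fun x => r x * eta x)), h1.
    + apply (RInt_correct (fun x => _ * eta x)), h2.
    + apply (RInt_correct (fun x => _ * eta x)), h3.
Qed.

Lemma ray_increment_open x y :
  phi0 < x -> x < y ->
  r y - r x = RInt ray_slope x y - 1 * crossed x y (2 * PI) - cot alpha * crossed x y phi1.
Proof.
  assert (o := angle_order).
  apply (increment_of_distribution r ray_slope phi0).
  - intros z hz; apply (ray_right_continuous _ _ hr); lra.
  - intros a b ha hab; apply ex_RInt_ray; lra.
  - intros a b ha hab; apply ex_RInt_ray_slope; lra.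
  - intros a b eta ha hab heta.
    rewrite pairing_ray_slope; [|lra|lra|].
    + rewrite (ray_delay_equation _ _ hr a b eta ha hab heta); unfold ray_delayed; ring.
    + intros z; apply (ex_derive_continuous eta), (proj1 heta 1%nat).
Qed.

(** Right continuity extends the identity to the initial point. *)
Lemma ray_increment x y :
  phi0 <= x -> x <= y ->
  r y - r x = RInt ray_slope x y - crossed x y (2 * PI) - cot alpha * crossed x y phi1.
Proof.
  intros hx hxy; assert (o := angle_order).
  destruct hxy as [hxy | <-].
  2: { rewrite RInt_point; unfold zero; simpl; unfold crossed.
       destruct (Rlt_dec x (2 * PI)), (Rlt_dec x phi1);
       repeat match goal with |- context [Rle_dec ?a ?b] => destruct (Rle_dec a b) end; lra. }
  destruct hx as [hx | <-]; [rewrite (ray_increment_open x y); lra|].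
  destruct (ex_RInt_ub ray_slope phi0 y (ex_RInt_ray_slope phi0 y ltac:(lra) ltac:(lra))) as [M hM].
  rewrite Rmin_left, Rmax_right in hM by lra.
  assert (hM0 : 0 <= M) by (apply Rle_trans with (2 := hM phi0 ltac:(lra)), norm_ge_0).
  apply Req_lt_aux; intros eps.
  assert (he2 : 0 < eps / 2) by (generalize (cond_pos eps); lra).
  destruct (right_continuous_close r phi0 (eps / 2 / 2)) as [e1 [he1 H1]];
    [lra | apply (ray_right_continuous _ _ hr); lra |].
  assert (hd : 0 < eps / 2 / (M + 1)) by (apply Rdiv_lt_0_compat; lra).
  destruct (smaller_positive e1 (eps / 2 / (M + 1))) as [c1 [? []]]; try easy.
  destruct (smaller_positive (y - phi0) (2 * PI - phi0)) as [c2 [? []]]; try lra.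
  destruct (smaller_positive c1 c2) as [c3 [? []]]; try easy.
  set (z := phi0 + c3 / 2).
  assert (hz : phi0 < z < phi0 + c3) by (unfold z; lra).
  assert (E := ray_increment_open z y ltac:(lra) ltac:(lra)).
  specialize (H1 z ltac:(lra)); apply Rabs_le_between in H1.
  rewrite (RInt_split ray_slope phi0 z y) by (lra || (apply ex_RInt_ray_slope; lra)).
  replace (crossed phi0 y (2 * PI)) with (crossed z y (2 * PI)).
  2: { unfold crossed; destruct (Rlt_dec z (2 * PI)), (Rlt_dec phi0 (2 * PI)); lra. }
  replace (crossed phi0 y phi1) with (crossed z y phi1).
  2: { unfold crossed; destruct (Rlt_dec z phi1), (Rlt_dec phi0 phi1); lra. }
  assert (B : Rabs (RInt ray_slope phi0 z) <= (z - phi0) * M).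
  { apply abs_RInt_le_const; [lra | apply ex_RInt_ray_slope; lra | intros t ht; apply (hM t); lra]. }
  assert (B' : (z - phi0) * M < eps / 2).
  { apply Rle_lt_trans with ((z - phi0) * (M + 1)); [nra|].
    apply Rlt_le_trans with (eps / 2 / (M + 1) * (M + 1)); [apply Rmult_lt_compat_r; lra|].
    right; field; lra. }
  apply Rabs_le_between in B; apply Rabs_def1; lra.
Qed.

Lemma crossed_none x y p : y < p -> crossed x y p = 0.
Proof.
  intros h; unfold crossed; destruct (Rlt_dec x p); [destruct (Rle_dec p y); lra | easy].
Qed.

Lemma crossed_before x y p : p <= x -> crossed x y p = 0.
Proof. intros h; unfold crossed; destruct (Rlt_dec x p); [lra | easy]. Qed.

Lemma crossed_one x y p : x < p -> p <= y -> crossed x y p = 1.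
Proof.
  intros h h'; unfold crossed; destruct (Rlt_dec x p); [destruct (Rle_dec p y); lra | lra].
Qed.

Lemma continuous_ray_primitive p x : 0 <= p -> 0 < x ->
  continuous (fun y => RInt ray_slope p y) x.
Proof.
  intros hp hx; apply continuous_primitive with 0; [easy|].
  intros y hy; apply ex_RInt_ray_slope; lra.
Qed.

Lemma continuous_shifted_primitive (c p x : R) : 0 <= p -> 0 < x ->
  continuous (fun y => c + RInt ray_slope p y) x.
Proof.
  intros hp hx; apply (continuous_plus (fun _ => c)); [apply continuous_const|].
  now apply continuous_ray_primitive.
Qed.

Lemma continuous_ray x : phi0 < x -> x <> 2 * PI -> x <> phi1 -> continuous r x.
Proof.
  intros hx h1 h2; assert (o := angle_order).
  assert (H : forall p q, phi0 <= p -> p < x < q ->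
    (forall y, p < y < q -> crossed p y (2 * PI) = 0 /\ crossed p y phi1 = 0) -> continuous r x).
  { intros p q hp hpq hcr.
    apply (continuous_ext_loc r (fun y => r p + RInt ray_slope p y)).
    - apply (locally_between p q); [easy|]; intros y hy.
      assert (E := ray_increment p y hp ltac:(lra)); destruct (hcr y hy) as [c1 c2].
      rewrite c1, c2 in E; lra.
    - apply continuous_shifted_primitive; lra. }
  destruct (Rlt_dec x (2 * PI)); [|destruct (Rlt_dec x phi1)].
  - apply (H phi0 (2 * PI)); [lra | lra |].
    intros y hy; split; apply crossed_none; lra.
  - apply (H (2 * PI) phi1); [lra | lra |].
    intros y hy; split; [apply crossed_before | apply crossed_none]; lra.
  - apply (H phi1 (x + 1)); [lra | lra |].
    intros y hy; split; apply crossed_before; lra.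
Qed.

Lemma cot_pos : 0 < cot alpha.
Proof. generalize (cot_enclosure alpha halpha); lra. Qed.

(** Between jumps the ray solves an affine equation with constant coefficients;
    a jump at the right end [q] affects the value at [q] only. *)
Lemma ray_on_piece (p q h : R) :
  phi0 <= p -> p < q ->
  (forall y, p <= y < q -> crossed p y (2 * PI) = 0 /\ crossed p y phi1 = 0) ->
  (forall y, p < y < q -> ray_slope y = cot alpha * r y - h) ->
  let S y := (r p - h / cot alpha) * exp (cot alpha * (y - p)) + h / cot alpha in
  (forall y, p <= y < q -> r y = S y) /\
  r q = S q - crossed p q (2 * PI) - cot alpha * crossed p q phi1.
Proof.
  intros hp hpq hcr hsl S; assert (o := angle_order); assert (hk := cot_pos).
  set (v := fun y => r p + RInt ray_slope p y).
  assert (hv : forall y, p <= y < q -> r y = v y).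
  { intros y hy; assert (E := ray_increment p y hp ltac:(lra)); destruct (hcr y hy) as [c1 c2].
    rewrite c1, c2 in E; unfold v; lra. }
  assert (hc : forall y, p <= y -> continuous v y).
  { intros y hy; apply continuous_shifted_primitive; lra. }
  assert (hS : forall y, is_derive S y (cot alpha * (S y - h / cot alpha))).
  { intros y; unfold S; auto_derive; [easy | unfold Rminus; ring]. }
  assert (hvS : forall y, p <= y <= q -> v y = S y).
  { intros y hy.
    apply (linear_uniqueness (cot alpha) v (fun x => cot alpha * v x - h)
             S (fun x => cot alpha * (S x - h / cot alpha)) p y).
    - lra.
    - intros x hx; apply (is_derive_ext_loc (fun z => r p + RInt ray_slope p z)).
      { apply filter_forall; reflexivity. }
      replace (cot alpha * v x - h) with (0 + ray_slope x) by (rewrite hsl, hv by lra; ring).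
      apply (is_derive_plus (fun _ => r p) (fun z => RInt ray_slope p z)).
      + apply @is_derive_const.
      + apply is_derive_primitive with 0; [lra | intros z hz; apply ex_RInt_ray_slope; lra |].
        apply (continuous_ext_loc ray_slope (fun z => cot alpha * v z - h)).
        * apply (locally_between p q); [lra|]; intros z hz; rewrite hsl, hv by lra; reflexivity.
        * apply (continuous_minus (fun z => cot alpha * v z) (fun _ => h)); [|apply continuous_const].
          apply (continuous_scal_r (cot alpha) v), hc; lra.
    - intros; apply hS.
    - intros; apply hc; lra.
    - intros; apply (ex_derive_continuous S); eexists; apply hS.
    - intros; field; lra.
    - unfold v, S; rewrite RInt_point, Rminus_diag, Rmult_0_r, exp_0.
      change (r p + 0 = (r p - h / cot alpha) * 1 + h / cot alpha); ring. }
  split.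
  - intros y hy; rewrite hv by easy; apply hvS; lra.
  - rewrite <- hvS by lra; assert (E := ray_increment p q hp ltac:(lra)); unfold v; lra.
Qed.

(** ** The normalised ray length on the first period *)

(** Time in units of the delay, counted from the end of the segment, and with
    the growth at the double characteristic root removed. *)
Definition rho (t : R) : R := r (phi0 + T * t) * exp (- (k * t)).

Lemma period_pos : 0 < T.
Proof. generalize (period_enclosure alpha halpha); lra. Qed.

Lemma sin_pos : 0 < sin alpha.
Proof. generalize (sin_enclosure alpha halpha); lra. Qed.

Lemma cos_pos : 0 < cos alpha.
Proof. generalize (cos_enclosure alpha halpha); lra. Qed.

Lemma t_jump_eq : phi0 + T * t_jump alpha = 2 * PI.
Proof. unfold t_jump; field; generalize period_pos; lra. Qed.

Lemma t_arc_eq : phi0 + T * t_arc alpha = 5 * PI / 2.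
Proof. unfold t_arc; field; generalize period_pos; lra. Qed.

Lemma rate_eq : cot alpha * T = k + 1.
Proof. unfold rate; ring. Qed.

Lemma ray_slope_before phi : phi < 5 * PI / 2 -> ray_slope phi = cot alpha * r phi - 0.
Proof.
  intros h; assert (o := angle_order); unfold ray_slope, indicator_Icc.
  rewrite ray_delayed_zero by lra; destruct (Rle_dec (5 * PI / 2) phi); lra.
Qed.

Lemma ray_slope_middle phi :
  5 * PI / 2 <= phi <= phi1 -> ray_slope phi = cot alpha * r phi - 1.
Proof.
  intros h; assert (o := angle_order); unfold ray_slope, indicator_Icc.
  rewrite ray_delayed_zero by lra.
  destruct (Rle_dec (5 * PI / 2) phi), (Rle_dec phi phi1); lra.
Qed.

Lemma ray_slope_after phi :
  phi1 < phi -> ray_slope phi = cot alpha * r phi - r (phi - T) / sin alpha.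
Proof.
  intros h; assert (o := angle_order); unfold ray_slope, indicator_Icc.
  rewrite ray_delayed_after by lra.
  destruct (Rle_dec (5 * PI / 2) phi), (Rle_dec phi phi1); lra.
Qed.

(** The segment ends at the angle [alpha] with the fire ray. *)
Lemma ray_initial : r phi0 = amp0 alpha.
Proof.
  assert (o := angle_order).
  assert (ha := alpha_enclosure alpha halpha); assert (hpi := PI_enclosure).
  rewrite (ray_on_segment _ _ hr) by (unfold segment_end; lra).
  unfold segment_end, amp0; replace (tan alpha + PI / 2 - alpha - tan alpha) with (PI / 2 - alpha) by ring.
  rewrite cos_shift; field; generalize sin_pos; lra.
Qed.

Lemma ray_piece0 :
  (forall y, phi0 <= y < 2 * PI -> r y = amp0 alpha * exp (cot alpha * (y - phi0))) /\
  r (2 * PI) = amp0 alpha * exp (cot alpha * (2 * PI - phi0)) - 1.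
Proof.
  assert (o := angle_order); assert (hk := cot_pos).
  destruct (ray_on_piece phi0 (2 * PI) 0) as [h1 h2]; try lra.
  - intros y hy; split; apply crossed_none; lra.
  - intros y hy; apply ray_slope_before; lra.
  - rewrite ray_initial in h1, h2; rewrite crossed_one, crossed_none in h2 by lra.
    replace (0 / cot alpha) with 0 in h1, h2 by (field; lra).
    split; [intros y hy; rewrite h1 by easy; ring | rewrite h2; ring].
Qed.

Lemma ray_piece1 y :
  2 * PI <= y <= 5 * PI / 2 -> r y = r (2 * PI) * exp (cot alpha * (y - 2 * PI)).
Proof.
  assert (o := angle_order); assert (hk := cot_pos).
  destruct (ray_on_piece (2 * PI) (5 * PI / 2) 0) as [h1 h2]; try lra.
  - intros z hz; split; [apply crossed_before | apply crossed_none]; lra.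
  - intros z hz; apply ray_slope_before; lra.
  - rewrite crossed_before, crossed_none in h2 by lra.
    replace (0 / cot alpha) with 0 in h1, h2 by (field; lra).
    intros [hy [hy'| ->]]; [rewrite h1 by lra | rewrite h2]; ring.
Qed.

Lemma tan_inv_cot : 1 / cot alpha = tan alpha.
Proof.
  unfold cot, tan; field; generalize sin_pos cos_pos; lra.
Qed.

Lemma ray_piece2 :
  let S y := (r (5 * PI / 2) - tan alpha) * exp (cot alpha * (y - 5 * PI / 2)) + tan alpha in
  (forall y, 5 * PI / 2 <= y < phi1 -> r y = S y) /\ r phi1 = S phi1 - cot alpha.
Proof.
  assert (o := angle_order); assert (hk := cot_pos).
  destruct (ray_on_piece (5 * PI / 2) phi1 1) as [h1 h2]; try lra.
  - intros y hy; split; [apply crossed_before | apply crossed_none]; lra.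
  - intros y hy; apply ray_slope_middle; lra.
  - rewrite crossed_before, crossed_one in h2 by lra; rewrite tan_inv_cot in h1, h2.
    split; [exact h1 | rewrite h2; ring].
Qed.

Lemma exp_scaled p t : exp (cot alpha * (phi0 + T * t - (phi0 + T * p))) = exp ((k + 1) * (t - p)).
Proof. f_equal; rewrite <- rate_eq; ring. Qed.

Lemma rho_piece0 t : 0 <= t < t_jump alpha -> rho t = amp0 alpha * exp t.
Proof.
  intros h; assert (hT := period_pos); assert (e := t_jump_eq); unfold rho.
  rewrite (proj1 ray_piece0) by nra.
  replace (phi0 + T * t - phi0) with (phi0 + T * t - (phi0 + T * 0)) by ring.
  rewrite exp_scaled, Rmult_assoc, <- exp_plus; do 2 f_equal; ring.
Qed.

Lemma ray_2PI : r (2 * PI) = amp1 alpha * exp ((k + 1) * t_jump alpha).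
Proof.
  rewrite (proj2 ray_piece0), <- t_jump_eq.
  replace (phi0 + T * t_jump alpha - phi0) with (phi0 + T * t_jump alpha - (phi0 + T * 0)) by ring.
  rewrite exp_scaled; unfold amp1, Rdiv; rewrite <- exp_Ropp, <- exp_plus.
  rewrite Rmult_minus_distr_r, <- exp_plus.
  replace (_ + _ * t_jump alpha) with 0 by ring. rewrite exp_0.
  do 3 f_equal; ring.
Qed.

Lemma rho_piece1 t : t_jump alpha <= t <= t_arc alpha -> rho t = amp1 alpha * exp t.
Proof.
  intros h; assert (hT := period_pos); assert (e := t_jump_eq); assert (e' := t_arc_eq); unfold rho.
  rewrite ray_piece1, ray_2PI by nra; rewrite <- e at 1.
  rewrite exp_scaled, !Rmult_assoc, <- !exp_plus; do 2 f_equal; ring.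
Qed.

Lemma ray_5PI2 : r (5 * PI / 2) = amp1 alpha * exp ((k + 1) * t_arc alpha).
Proof.
  assert (hT := period_pos); assert (e := t_jump_eq); assert (e' := t_arc_eq).
  assert (o := angle_order).
  rewrite ray_piece1, ray_2PI by lra; rewrite <- e, <- e'.
  rewrite exp_scaled, !Rmult_assoc, <- !exp_plus; do 2 f_equal; ring.
Qed.

Lemma ray_piece2_scaled t :
  ((r (5 * PI / 2) - tan alpha) * exp (cot alpha * (phi0 + T * t - 5 * PI / 2)) + tan alpha)
    * exp (- (k * t))
  = amp2 alpha * exp t + tan alpha * exp (- (k * t)).
Proof.
  rewrite ray_5PI2, <- t_arc_eq, exp_scaled; unfold amp2, Rdiv; rewrite <- exp_Ropp.
  rewrite Rmult_plus_distr_r, !Rmult_minus_distr_r, <- exp_plus.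
  rewrite !Rmult_assoc, <- !exp_plus.
  replace ((k + 1) * t_arc alpha + ((k + 1) * (t - t_arc alpha) + - (k * t))) with t by ring.
  replace ((k + 1) * (t - t_arc alpha) + - (k * t))
    with (- (k * t_arc alpha) + - t_arc alpha + t) by ring.
  reflexivity.
Qed.

Lemma rho_piece2 t :
  t_arc alpha <= t < 1 -> rho t = amp2 alpha * exp t + tan alpha * exp (- (k * t)).
Proof.
  intros h; assert (hT := period_pos); assert (e' := t_arc_eq); assert (e1 := phi1_eq); unfold rho.
  rewrite (proj1 ray_piece2) by nra; apply ray_piece2_scaled.
Qed.

Lemma rho_1 : rho 1 = lev0 alpha.
Proof.
  unfold rho; replace (phi0 + T * 1) with phi1 by (rewrite phi1_eq; ring).
  rewrite (proj2 ray_piece2), Rmult_minus_distr_r.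
  rewrite phi1_eq; replace (phi0 + T) with (phi0 + T * 1) by ring.
  rewrite ray_piece2_scaled; unfold lev0; rewrite !Rmult_1_r; ring.
Qed.

Lemma rho_continuous t : 0 < t -> t <> t_jump alpha -> t <> 1 -> continuous rho t.
Proof.
  intros h0 h1 h2; assert (hT := period_pos).
  assert (e := t_jump_eq); assert (e1 := phi1_eq).
  apply (continuous_mult (fun t => r (phi0 + T * t)) (fun t => exp (- (k * t)))).
  - apply (continuous_comp (fun t => phi0 + T * t) r).
    + apply (ex_derive_continuous (fun t => phi0 + T * t)); auto_derive; easy.
    + apply continuous_ray; [nra | |].
      * rewrite <- e; intros E; apply h1, (Rmult_eq_reg_l T); lra.
      * rewrite e1; intros E; apply h2, (Rmult_eq_reg_l T); lra.
  - apply (ex_derive_continuous (fun t => exp (- (k * t)))); auto_derive; easy.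
Qed.

(** ** The delay equation *)

(** Coincides with [rho] on [1, +oo) and, unlike [rho], is continuous at 1. *)
Definition sigma (t : R) : R :=
  (r phi1 + RInt ray_slope phi1 (phi0 + T * t)) * exp (- (k * t)).

Lemma sigma_rho t : 1 <= t -> sigma t = rho t.
Proof.
  intros h; assert (hT := period_pos); assert (e1 := phi1_eq); assert (o := angle_order).
  unfold sigma, rho; f_equal.
  assert (E := ray_increment phi1 (phi0 + T * t) ltac:(lra) ltac:(nra)).
  rewrite !crossed_before in E by lra; lra.
Qed.

Lemma sigma_continuous t : 0 < t -> continuous sigma t.
Proof.
  intros h; assert (hT := period_pos); assert (o := angle_order).
  apply (continuous_mult (fun t => r phi1 + RInt ray_slope phi1 (phi0 + T * t))
           (fun t => exp (- (k * t)))).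
  - apply (continuous_comp (fun t => phi0 + T * t) (fun y => r phi1 + RInt ray_slope phi1 y)).
    + apply (ex_derive_continuous (fun t => phi0 + T * t)); auto_derive; easy.
    + apply continuous_shifted_primitive; [lra | nra].
  - apply (ex_derive_continuous (fun t => exp (- (k * t)))); auto_derive; easy.
Qed.

Lemma exp_rate : exp (- k) * (T / sin alpha) = 1.
Proof.
  rewrite (exp_neg_rate alpha halpha); field; generalize sin_pos period_pos; lra.
Qed.

Lemma rho_shift t : rho (t - 1) = T / sin alpha * (r (phi0 + T * t - T) * exp (- (k * t))).
Proof.
  unfold rho; replace (phi0 + T * (t - 1)) with (phi0 + T * t - T) by ring.
  replace (- (k * (t - 1))) with (- (k * t) + - - k) by ring.
  rewrite exp_plus, (exp_Ropp (- k)).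
  assert (E := exp_rate); assert (h := exp_pos (- k)).
  replace (/ exp (- k)) with (T / sin alpha).
  - ring.
  - apply (Rmult_eq_reg_l (exp (- k))); [|lra]; rewrite E; field; lra.
Qed.

(** Both coefficients equal 1: that of [rho t] is [T * cot alpha - k], that of
    [rho (t - 1)] is [T / sin alpha * exp (- k)].  The excluded times are one
    period after the jumps of [rho]. *)
Lemma sigma_derive t :
  1 < t -> t <> 1 + t_jump alpha -> t <> 2 -> is_derive sigma t (sigma t - rho (t - 1)).
Proof.
  intros h h1 h2; assert (hT := period_pos); assert (o := angle_order).
  assert (e1 := phi1_eq); assert (e := t_jump_eq).
  assert (hj := t_jump_enclosure alpha halpha).
  set (y := phi0 + T * t).
  assert (hy : phi1 < y) by (unfold y; nra).
  assert (D : is_derive (fun t => RInt ray_slope phi1 (phi0 + T * t)) t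
                (T * ray_slope y)).
  { apply (is_derive_comp (fun z => RInt ray_slope phi1 z) (fun t => phi0 + T * t)).
    - apply is_derive_primitive with 0; [lra | intros z hz; apply ex_RInt_ray_slope; lra |].
      apply (continuous_ext_loc ray_slope (fun z => cot alpha * r z - r (1 * z + - T) * / sin alpha)).
      + apply (locally_between phi1 (y + 1)); [unfold y in *; lra|]; intros z hz.
        rewrite ray_slope_after by lra; replace (1 * z + - T) with (z - T) by ring; reflexivity.
      + apply (continuous_minus (fun z => cot alpha * r z) (fun z => r (1 * z + - T) * / sin alpha)).
        * apply (continuous_scal_r (cot alpha) r), continuous_ray; lra.
        * apply (continuous_mult (fun z => r (1 * z + - T)) (fun _ => / sin alpha));
            [|apply continuous_const].
          apply (continuous_comp (fun z => 1 * z + - T) r).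
          -- apply (ex_derive_continuous (fun z => 1 * z + - T)); auto_derive; easy.
          -- apply continuous_ray; unfold y in *; [nra | |].
             ++ rewrite <- e; intros E; apply h1, (Rmult_eq_reg_l T); lra.
             ++ rewrite e1; intros E; apply h2, (Rmult_eq_reg_l T); lra.
    - auto_derive; [easy | ring]. }
  evar_last.
  - apply (is_derive_mult (fun t => r phi1 + RInt ray_slope phi1 (phi0 + T * t))
             (fun t => exp (- (k * t)))).
    + apply (is_derive_plus (fun _ => r phi1)); [apply @is_derive_const | exact D].
    + instantiate (1 := - k * exp (- (k * t))); auto_derive; [easy | ring].
    + intros; apply Rmult_comm.
  - change ((0 + T * ray_slope y) * exp (- (k * t))
      + (r phi1 + RInt ray_slope phi1 y) * (- k * exp (- (k * t))) = sigma t - rho (t - 1)).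
    rewrite rho_shift; fold y; rewrite ray_slope_after by easy.
    assert (E := sigma_rho t ltac:(lra)); unfold sigma, rho in *; fold y in E |- *.
    assert (hx := exp_pos (- (k * t))).
    assert (E' : r phi1 + RInt ray_slope phi1 y = r y) by (apply (Rmult_eq_reg_r (exp (- (k * t)))); lra).
    rewrite E'; unfold rate; field; generalize sin_pos; lra.
Qed.

(** ** The length of the spiral *)

Lemma spiral_length_after y :
  phi0 <= y ->
  spiral_length alpha r y
  = tan alpha + cot alpha + RInt (fun psi => r psi / sin alpha) phi0 y.
Proof.
  intros hy; assert (o := angle_order).
  assert (ha := alpha_enclosure alpha halpha); assert (hpi := PI_enclosure).
  unfold spiral_length; destruct (Rlt_dec y 0); [lra|].
  destruct (Rle_dec y (tan alpha)); [unfold segment_end in *; lra|].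
  destruct (Rle_dec y phi0); [|easy].
  replace y with phi0 by lra; rewrite RInt_point.
  change (tan alpha + tan (phi0 - tan alpha) = tan alpha + cot alpha + 0).
  unfold segment_end; replace (tan alpha + PI / 2 - alpha - tan alpha) with (PI / 2 - alpha) by ring.
  unfold cot, tan at 2; rewrite sin_shift, cos_shift; ring.
Qed.

Lemma spiral_length_before y :
  y <= phi0 ->
  (y <= 0 -> spiral_length alpha r y = 0) /\
  (0 <= y <= tan alpha -> spiral_length alpha r y = y) /\
  (tan alpha <= y -> spiral_length alpha r y <= tan alpha + cot alpha).
Proof.
  intros hy; assert (ha := alpha_enclosure alpha halpha); assert (hpi := PI_enclosure).
  assert (ht := tan_enclosure alpha halpha); assert (hc := cot_pos).
  unfold spiral_length.
  destruct (Rlt_dec y 0); [repeat split; intros; lra|].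
  destruct (Rle_dec y (tan alpha)); [repeat split; intros; lra|].
  destruct (Rle_dec y phi0); [|lra].
  repeat split; intros; try lra.
  apply Rplus_le_compat_l.
  replace (cot alpha) with (tan (PI / 2 - alpha)) by (unfold tan, cot; now rewrite sin_shift, cos_shift).
  unfold segment_end in hy.
  destruct (Rle_lt_or_eq_dec (y - tan alpha) (PI / 2 - alpha)) as [h' | ->]; [lra | | lra].
  left; apply tan_increasing; lra.
Qed.

(** A logarithmic spiral of pitch [alpha] is [1 / cos alpha] times as long as
    its ray; the other terms restore what the ray lost on the way. *)
Lemma spiral_length_first_turn y :
  phi0 <= y <= phi1 ->
  spiral_length alpha r y
  = (r y + crossed phi0 y (2 * PI) + cot alpha * crossed phi0 y phi1
     + RInt (indicator_Icc (5 * PI / 2) phi1) phi0 y) / cos alpha.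
Proof.
  intros hy; assert (o := angle_order); rewrite spiral_length_after by lra.
  assert (E := ray_increment phi0 y ltac:(lra) ltac:(lra)).
  assert (hr' : ex_RInt r phi0 y) by (apply ex_RInt_ray; lra).
  assert (E1 : RInt ray_slope phi0 y
    = cot alpha * RInt r phi0 y - RInt (indicator_Icc (5 * PI / 2) phi1) phi0 y).
  { apply (is_RInt_unique ray_slope).
    apply is_RInt_ext with (fun x => minus (scal (cot alpha) (r x)) (indicator_Icc (5 * PI / 2) phi1 x)).
    - rewrite Rmin_left, Rmax_right by lra; intros x hx; unfold ray_slope.
      rewrite ray_delayed_zero by lra.
      change (cot alpha * r x - indicator_Icc (5 * PI / 2) phi1 x
        = cot alpha * r x - indicator_Icc (5 * PI / 2) phi1 x - 0); ring.
    - apply (is_RInt_minus (V := R_NormedModule)).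
      + apply (is_RInt_scal (V := R_NormedModule)), (RInt_correct r), hr'.
      + apply (RInt_correct (indicator_Icc (5 * PI / 2) phi1)), ex_RInt_indicator_Icc; lra. }
  assert (E2 : RInt (fun psi => r psi / sin alpha) phi0 y = / sin alpha * RInt r phi0 y).
  { apply (is_RInt_unique (fun psi => r psi / sin alpha)).
    apply is_RInt_ext with (fun x => scal (/ sin alpha) (r x)).
    - intros x _; apply Rmult_comm.
    - apply (is_RInt_scal (V := R_NormedModule)), (RInt_correct r), hr'. }
  rewrite E2; rewrite E1, ray_initial in E; unfold amp0 in E.
  assert (hs := sin_pos); assert (hc := cos_pos).
  assert (E3 : RInt r phi0 y = (r y - / sin alpha + crossed phi0 y (2 * PI)
    + cot alpha * crossed phi0 y phi1 + RInt (indicator_Icc (5 * PI / 2) phi1) phi0 y) / cot alpha).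
  { apply (Rmult_eq_reg_l (cot alpha)); [|generalize cot_pos; lra].
    transitivity (r y - / sin alpha + crossed phi0 y (2 * PI)
      + cot alpha * crossed phi0 y phi1 + RInt (indicator_Icc (5 * PI / 2) phi1) phi0 y); [lra|].
    field; generalize cot_pos; lra. }
  rewrite E3; unfold cot, tan.
  assert (E4 := sin2_cos2 alpha); unfold Rsqr in E4.
  apply Rminus_diag_uniq.
  transitivity ((sin alpha * sin alpha + cos alpha * cos alpha - 1) / (sin alpha * cos alpha)).
  - field; lra.
  - rewrite E4; field; lra.
Qed.

(** The length delayed by one period, in the scale of [rho]. *)
Definition ell (t : R) : R := spiral_length alpha r (phi0 + T * (t - 1)) * exp (- (k * t)).

Lemma exp_rate_cos : exp (- k) / cos alpha = / (k + 1).
Proof.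
  rewrite (exp_neg_rate alpha halpha), <- rate_eq; unfold cot.
  field; generalize sin_pos cos_pos period_pos; lra.
Qed.

Lemma RInt_arc_zero y : phi0 <= y <= 5 * PI / 2 ->
  RInt (indicator_Icc (5 * PI / 2) phi1) phi0 y = 0.
Proof.
  intros h; apply RInt_zero_on; [lra|]; intros x hx; unfold indicator_Icc.
  destruct (Rle_dec (5 * PI / 2) x); lra.
Qed.

Lemma RInt_arc : RInt (indicator_Icc (5 * PI / 2) phi1) phi0 phi1 = tan alpha.
Proof.
  assert (o := angle_order).
  rewrite (RInt_split _ phi0 (5 * PI / 2) phi1) by (lra || (apply ex_RInt_indicator_Icc; lra)).
  rewrite RInt_arc_zero by lra; rewrite Rplus_0_l.
  rewrite (RInt_ext _ (fun _ => 1)).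
  - rewrite RInt_const; change ((phi1 - 5 * PI / 2) * 1 = tan alpha); ring.
  - rewrite Rmin_left, Rmax_right by lra; intros x hx; unfold indicator_Icc.
    destruct (Rle_dec (5 * PI / 2) x), (Rle_dec x phi1); lra.
Qed.

Lemma ell_first_turn x :
  0 <= x <= 1 ->
  ell (1 + x) = (rho x + exp (- (k * x)) * (crossed phi0 (phi0 + T * x) (2 * PI)
    + cot alpha * crossed phi0 (phi0 + T * x) phi1
    + RInt (indicator_Icc (5 * PI / 2) phi1) phi0 (phi0 + T * x))) / (k + 1).
Proof.
  intros hx; assert (hT := period_pos); assert (e1 := phi1_eq).
  unfold ell, rho; replace (1 + x - 1) with x by ring.
  rewrite spiral_length_first_turn by nra.
  replace (- (k * (1 + x))) with (- k + - (k * x)) by ring; rewrite exp_plus.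
  unfold Rdiv; rewrite <- exp_rate_cos; unfold Rdiv; ring.
Qed.

Lemma ell_piece0 x : 0 <= x < t_jump alpha -> ell (1 + x) = amp0 alpha * exp x / (k + 1).
Proof.
  intros hx; assert (hT := period_pos); assert (e := t_jump_eq); assert (o := angle_order).
  assert (hj := t_jump_enclosure alpha halpha).
  rewrite ell_first_turn, rho_piece0, !crossed_none, RInt_arc_zero by (lra || nra).
  unfold Rdiv; ring.
Qed.

Lemma ell_piece1 x : t_jump alpha <= x <= t_arc alpha ->
  ell (1 + x) = (amp1 alpha * exp x + exp (- (k * x))) / (k + 1).
Proof.
  intros hx; assert (hT := period_pos); assert (e := t_jump_eq); assert (o := angle_order).
  assert (e' := t_arc_eq).
  assert (hj := t_jump_enclosure alpha halpha); assert (ha := t_arc_enclosure alpha halpha).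
  rewrite ell_first_turn, rho_piece1 by lra.
  rewrite crossed_one, crossed_none, RInt_arc_zero by (lra || nra).
  unfold Rdiv; ring.
Qed.

Lemma ell_2 : ell 2 = (lev0 alpha + exp (- k) * (1 + cot alpha + tan alpha)) / (k + 1).
Proof.
  assert (o := angle_order); replace 2 with (1 + 1) by ring.
  rewrite ell_first_turn, rho_1 by lra; rewrite !Rmult_1_r, <- phi1_eq.
  rewrite !crossed_one, RInt_arc by lra; rewrite Rmult_1_r; unfold Rdiv; ring.
Qed.

Lemma ex_RInt_scaled_ray a b :
  0 <= a -> 0 <= b -> ex_RInt (fun psi => r psi / sin alpha) a b.
Proof.
  intros ha hb; apply ex_RInt_ext with (fun psi => scal (/ sin alpha) (r psi)).
  - intros; apply Rmult_comm.
  - apply (ex_RInt_scal r); now apply ex_RInt_ray.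
Qed.

Definition ell_ext (t : R) : R :=
  (tan alpha + cot alpha + RInt (fun psi => r psi / sin alpha) phi0 (phi0 + T * (t - 1)))
  * exp (- (k * t)).

Lemma ell_ell_ext t : 1 <= t -> ell t = ell_ext t.
Proof.
  intros h; unfold ell, ell_ext; rewrite spiral_length_after; [easy|].
  generalize period_pos; nra.
Qed.

Lemma ell_continuous t : 1 < t -> continuous ell t.
Proof.
  intros h; assert (hT := period_pos); assert (o := angle_order).
  apply (continuous_ext_loc ell ell_ext).
  - apply (locally_above 1); [easy|]; intros; symmetry; apply ell_ell_ext; lra.
  - apply (continuous_mult (fun t => tan alpha + cot alpha
      + RInt (fun psi => r psi / sin alpha) phi0 (phi0 + T * (t - 1))) (fun t => exp (- (k * t)))).
    + apply (continuous_plus (fun _ => tan alpha + cot alpha)); [apply continuous_const|].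
      apply (continuous_comp (fun t => phi0 + T * (t - 1))
        (fun y => RInt (fun psi => r psi / sin alpha) phi0 y)).
      * apply (ex_derive_continuous (fun t => phi0 + T * (t - 1))); auto_derive; easy.
      * apply continuous_primitive with 0; [nra|].
        intros; apply ex_RInt_scaled_ray; lra.
    + apply (ex_derive_continuous (fun t => exp (- (k * t)))); auto_derive; easy.
Qed.

Lemma ell_derive t :
  1 < t -> t <> 1 + t_jump alpha -> t <> 2 -> is_derive ell t (rho (t - 1) - k * ell t).
Proof.
  intros h h1 h2; assert (hT := period_pos); assert (o := angle_order).
  assert (e1 := phi1_eq); assert (e := t_jump_eq).
  apply (is_derive_ext_loc ell_ext).
  - apply (locally_above 1); [easy|]; intros; symmetry; apply ell_ell_ext; lra.
  - rewrite ell_ell_ext by lra.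
    assert (D : is_derive (fun t => RInt (fun psi => r psi / sin alpha) phi0 (phi0 + T * (t - 1))) t
              (T * (r (phi0 + T * (t - 1)) / sin alpha))).
    { apply (is_derive_comp (fun z => RInt (fun psi => r psi / sin alpha) phi0 z)
                            (fun t => phi0 + T * (t - 1))).
      - apply (is_derive_primitive (fun psi => r psi / sin alpha)) with 0;
          [nra | intros; apply ex_RInt_scaled_ray; lra |].
        apply (continuous_mult r (fun _ => / sin alpha)); [|apply continuous_const].
        apply continuous_ray; [nra | |].
        + rewrite <- e; intros E; apply h1; cut (t - 1 = t_jump alpha); [lra|].
          apply (Rmult_eq_reg_l T); lra.
        + rewrite e1; intros E; apply h2, (Rmult_eq_reg_l T); lra.
      - auto_derive; [easy | ring]. }
    evar_last.
    + apply (is_derive_mult (fun t => tan alpha + cot alpha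
        + RInt (fun psi => r psi / sin alpha) phi0 (phi0 + T * (t - 1))) (fun t => exp (- (k * t)))).
      * apply (is_derive_plus (fun _ => tan alpha + cot alpha)); [apply @is_derive_const | exact D].
      * instantiate (1 := - k * exp (- (k * t))); auto_derive; [easy | ring].
      * intros; apply Rmult_comm.
    + rewrite rho_shift; replace (phi0 + T * t - T) with (phi0 + T * (t - 1)) by ring.
      set (L := RInt (fun psi => r psi / sin alpha) phi0 (phi0 + T * (t - 1))).
      change ((0 + T * (r (phi0 + T * (t - 1)) / sin alpha)) * exp (- (k * t))
        + (tan alpha + cot alpha + L) * (- k * exp (- (k * t)))
        = T / sin alpha * (r (phi0 + T * (t - 1)) * exp (- (k * t)))
          - k * ((tan alpha + cot alpha + L) * exp (- (k * t)))).
      field; generalize sin_pos; lra.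
Qed.

(** ** The conserved quantity *)

Lemma ex_RInt_rho a b : -1/4 <= a -> -1/4 <= b -> ex_RInt rho a b.
Proof.
  assert (H : forall a b, -1/4 <= a -> a <= b -> ex_RInt rho a b).
  { clear a b; intros a b ha hab.
    assert (hT := period_enclosure alpha halpha); assert (h0 := segment_end_enclosure alpha halpha).
    apply (ex_RInt_mult_continuous (fun t => r (phi0 + T * t)) (fun t => exp (- (k * t)))); [easy| |].
    - apply ex_RInt_ext with (fun t => scal (/ T) (scal T (r (T * t + phi0)))).
      + intros t _; rewrite (Rplus_comm (T * t)); unfold scal; simpl; unfold mult; simpl.
        rewrite <- Rmult_assoc, Rinv_l by lra; apply Rmult_1_l.
      + apply (ex_RInt_scal (fun t => scal T (r (T * t + phi0)))), (ex_RInt_comp_lin r).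
        apply ex_RInt_ray; nra.
    - intros t; apply (ex_derive_continuous (fun t => exp (- (k * t)))); auto_derive; easy. }
  intros ha hb; destruct (Rle_dec a b); [now apply H | apply ex_RInt_swap, H; lra].
Qed.

Lemma RInt_rho_first_turn :
  RInt rho 0 1 = amp0 alpha * (exp (t_jump alpha) - 1)
    + amp1 alpha * (exp (t_arc alpha) - exp (t_jump alpha))
    + amp2 alpha * (exp 1 - exp (t_arc alpha))
    + tan alpha / k * (exp (- (k * t_arc alpha)) - exp (- k)).
Proof.
  assert (hj := t_jump_enclosure alpha halpha); assert (ha := t_arc_enclosure alpha halpha).
  assert (hk := rate_enclosure alpha halpha).
  assert (hexp : forall c a b, is_RInt (fun t => c * exp t) a b (c * (exp b - exp a))).
  { intros c a b; apply (is_RInt_scal exp a b c).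
    apply (is_RInt_derive exp exp); intros; [apply is_derive_exp | apply (continuous_exp _)]. }
  rewrite (RInt_split rho 0 (t_jump alpha) 1) by (lra || (apply ex_RInt_rho; lra)).
  rewrite (RInt_split rho (t_jump alpha) (t_arc alpha) 1) by (lra || (apply ex_RInt_rho; lra)).
  rewrite (is_RInt_unique rho 0 (t_jump alpha) (amp0 alpha * (exp (t_jump alpha) - exp 0))).
  2: { apply is_RInt_ext with (2 := hexp _ _ _); rewrite Rmin_left, Rmax_right by lra.
       intros x hx; symmetry; apply rho_piece0; lra. }
  rewrite (is_RInt_unique rho (t_jump alpha) (t_arc alpha)
    (amp1 alpha * (exp (t_arc alpha) - exp (t_jump alpha)))).
  2: { apply is_RInt_ext with (2 := hexp _ _ _); rewrite Rmin_left, Rmax_right by lra.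
       intros x hx; symmetry; apply rho_piece1; lra. }
  rewrite (is_RInt_unique rho (t_arc alpha) 1 (amp2 alpha * (exp 1 - exp (t_arc alpha))
    + tan alpha / k * (exp (- (k * t_arc alpha)) - exp (- k)))).
  2: { apply is_RInt_ext with (fun t => plus (amp2 alpha * exp t) (tan alpha * exp (- (k * t)))).
       - rewrite Rmin_left, Rmax_right by lra.
         intros x hx; symmetry; apply rho_piece2; lra.
       - apply (is_RInt_plus (V := R_NormedModule)); [apply hexp|].
         evar_last.
         + apply (is_RInt_derive (fun t => - tan alpha / k * exp (- (k * t)))
             (fun t => tan alpha * exp (- (k * t)))).
           * intros; auto_derive; [easy | field; lra].
           * intros; apply (ex_derive_continuous (fun t => tan alpha * exp (- (k * t)))).
             auto_derive; easy.
         + change (- tan alpha / k * exp (- (k * 1)) - - tan alpha / k * exp (- (k * t_arc alpha))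
             = tan alpha / k * (exp (- (k * t_arc alpha)) - exp (- k))).
           rewrite Rmult_1_r; field; lra. }
  rewrite exp_0; match goal with |- @eq _ ?a ?b => change (@eq R a b) end; ring.
Qed.

Lemma drift_eq : lev0 alpha - RInt rho 0 1 = drift alpha.
Proof.
  assert (hk := rate_enclosure alpha halpha).
  rewrite RInt_rho_first_turn; unfold drift, lev0, amp2, amp1.
  replace (period alpha) with (tan alpha * (k + 1)).
  - field; repeat split; try lra; generalize (exp_pos (t_jump alpha)) (exp_pos (t_arc alpha)); lra.
  - rewrite <- rate_eq, <- tan_inv_cot; field; generalize cot_pos; lra.
Qed.

(** The integral over the last period has the derivative [rho t - rho (t - 1)],
    which is also that of [sigma]. *)
Lemma rho_drift t : 1 <= t -> sigma t - RInt rho (t - 1) t = drift alpha.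
Proof.
  intros ht; assert (hj := t_jump_enclosure alpha halpha).
  set (Q := fun t => sigma t - (RInt rho 0 t - RInt rho 0 (t - 1))).
  assert (hQ : forall t, 1 <= t -> sigma t - RInt rho (t - 1) t = Q t).
  { intros x hx; unfold Q; rewrite <- (RInt_Chasles rho 0 (x - 1) x) by (apply ex_RInt_rho; lra).
    change (sigma x - RInt rho (x - 1) x
      = sigma x - ((RInt rho 0 (x - 1) + RInt rho (x - 1) x) - RInt rho 0 (x - 1))); ring. }
  assert (cQ : forall t, 1 <= t -> continuous Q t).
  { intros x hx; apply (continuous_minus sigma); [apply sigma_continuous; lra|].
    apply (continuous_minus (fun t => RInt rho 0 t)).
    - apply continuous_primitive with 0; [lra | intros; apply ex_RInt_rho; lra].
    - apply (continuous_comp (fun t => t - 1) (fun t => RInt rho 0 t)).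
      + apply (ex_derive_continuous (fun t => t - 1)); auto_derive; easy.
      + apply continuous_primitive with (-1/4); [lra | intros; apply ex_RInt_rho; lra]. }
  assert (dQ : forall t, 1 < t -> t <> 1 + t_jump alpha -> t <> 2 -> is_derive Q t 0).
  { intros x hx h1 h2; evar_last.
    - apply (is_derive_minus sigma); [apply sigma_derive; easy|].
      apply (is_derive_minus (fun t => RInt rho 0 t)).
      + apply is_derive_primitive with 0; [lra | intros; apply ex_RInt_rho; lra |].
        apply rho_continuous; lra.
      + apply (is_derive_comp (fun t => RInt rho 0 t) (fun t => t - 1)).
        * apply is_derive_primitive with 0; [lra | intros; apply ex_RInt_rho; lra |].
          apply rho_continuous; lra.
        * instantiate (1 := 1); auto_derive; [easy | ring].
    - change (sigma x - rho (x - 1) - (rho x - 1 * rho (x - 1)) = 0).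
      rewrite sigma_rho by lra; ring. }
  assert (cst : forall a b, 1 <= a -> a <= b ->
    (forall x, a < x < b -> x <> 1 + t_jump alpha /\ x <> 2) -> Q b = Q a).
  { intros a b ha hab hx; symmetry.
    apply (linear_uniqueness 0 (fun _ => Q a) (fun _ => 0) Q (fun _ => 0) a b); try easy.
    - intros x _; apply @is_derive_const.
    - intros x h; apply dQ; [lra | apply hx; lra | apply hx; lra].
    - intros x _; apply continuous_const.
    - intros x h; apply cQ; lra.
    - intros; ring. }
  assert (Q1 : Q 1 = drift alpha).
  { rewrite <- hQ, sigma_rho, rho_1 by lra.
    replace (1 - 1) with 0 by ring; apply drift_eq. }
  rewrite hQ, <- Q1 by easy.
  destruct (Rle_dec t (1 + t_jump alpha)); [apply cst; lra || (intros; lra)|].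
  transitivity (Q (1 + t_jump alpha)); [|apply cst; lra || (intros; lra)].
  destruct (Rle_dec t 2); [apply cst; lra || (intros; lra)|].
  transitivity (Q 2); apply cst; lra || (intros; lra).
Qed.

(** ** Exact solution on the second period *)

Notation A0 := (amp0 alpha).
Notation A1 := (amp1 alpha).
Notation A2 := (amp2 alpha).
Notation t2 := (t_jump alpha).
Notation t3 := (t_arc alpha).

(** Solves [sigma' = sigma - rho (t - 1)] from an explicit candidate [S]. *)
Lemma sigma_solution (S dS : R -> R) (a b : R) :
  1 <= a -> a <= b ->
  (forall t, a < t < b -> t <> 1 + t2 /\ t <> 2) ->
  (forall t, is_derive S t (dS t)) ->
  (forall t, a < t < b -> dS t - S t = - rho (t - 1)) ->
  sigma a = S a -> sigma b = S b.
Proof.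
  intros ha hab hne hS hd.
  apply (linear_uniqueness 1 sigma (fun t => sigma t - rho (t - 1)) S dS a b); try easy.
  - intros t ht; destruct (hne t ht); apply sigma_derive; lra.
  - intros t ht; apply sigma_continuous; lra.
  - intros t ht; apply (ex_derive_continuous S); eexists; apply hS.
  - intros t ht; specialize (hd t ht); lra.
Qed.

Lemma sigma_second_turn0 x : 0 <= x <= t2 -> sigma (1 + x) = exp x * (lev0 alpha - A0 * x).
Proof.
  intros hx; assert (hj := t_jump_enclosure alpha halpha).
  rewrite (sigma_solution (fun t => exp (t - 1) * (lev0 alpha - A0 * (t - 1)))
    (fun t => exp (t - 1) * (lev0 alpha - A0 * (t - 1)) - A0 * exp (t - 1)) 1 (1 + x)).
  - replace (1 + x - 1) with x by ring; reflexivity.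
  - lra.
  - lra.
  - intros; lra.
  - intros t; auto_derive; [easy | unfold Rminus; ring].
  - intros t ht; rewrite rho_piece0 by lra; ring.
  - rewrite sigma_rho, rho_1 by lra; rewrite Rminus_diag, exp_0; ring.
Qed.

Lemma sigma_second_turn1 x :
  t2 <= x <= t3 -> sigma (1 + x) = exp x * (lev1 alpha - A1 * (x - t2)).
Proof.
  intros hx; assert (hj := t_jump_enclosure alpha halpha); assert (ha := t_arc_enclosure alpha halpha).
  rewrite (sigma_solution (fun t => exp (t - 1) * (lev1 alpha - A1 * (t - 1 - t2)))
    (fun t => exp (t - 1) * (lev1 alpha - A1 * (t - 1 - t2)) - A1 * exp (t - 1)) (1 + t2) (1 + x)).
  - replace (1 + x - 1) with x by ring; reflexivity.
  - lra.
  - lra.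
  - intros; lra.
  - intros t; auto_derive; [easy | unfold Rminus; ring].
  - intros t ht; rewrite rho_piece1 by lra; ring.
  - rewrite sigma_second_turn0 by lra; replace (1 + t2 - 1) with t2 by ring; unfold lev1; ring.
Qed.

Notation ratio := (exp (- (k * t3)) / exp t3).

Lemma exp_decay_from_arc x : exp (- ((k + 1) * x)) = ratio * exp (- ((k + 1) * (x - t3))).
Proof.
  unfold Rdiv; rewrite <- exp_Ropp, <- !exp_plus; f_equal; ring.
Qed.

Lemma sigma_second_turn2 x :
  t3 <= x <= 1 ->
  sigma (1 + x) = exp x * (lev2 alpha - A2 * (x - t3)
    - tan alpha / (k + 1) * (ratio - exp (- ((k + 1) * x)))).
Proof.
  intros hx; assert (hj := t_jump_enclosure alpha halpha); assert (ha := t_arc_enclosure alpha halpha).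
  assert (hk := rate_enclosure alpha halpha).
  set (G := fun t => lev2 alpha - A2 * (t - 1 - t3)
    - tan alpha / (k + 1) * (ratio - exp (- ((k + 1) * (t - 1))))).
  rewrite (sigma_solution (fun t => exp (t - 1) * G t)
    (fun t => exp (t - 1) * G t + exp (t - 1) * (- A2 - tan alpha * exp (- ((k + 1) * (t - 1)))))
    (1 + t3) (1 + x)).
  - unfold G; replace (1 + x - 1) with x by ring; reflexivity.
  - lra.
  - lra.
  - intros; lra.
  - intros t; unfold G; auto_derive; [easy | unfold Rminus; field; generalize (exp_pos t3); lra].
  - intros t ht; rewrite rho_piece2 by lra.
    replace (- (k * (t - 1))) with (t - 1 + - ((k + 1) * (t - 1))) by ring.
    rewrite exp_plus; ring.
  - rewrite sigma_second_turn1 by lra; unfold G.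
    replace (1 + t3 - 1) with t3 by ring; rewrite (exp_decay_from_arc t3).
    rewrite Rminus_diag, !Rmult_0_r, Ropp_0, exp_0; unfold lev2; ring.
Qed.

Lemma sigma_2 : sigma 2 = rho2 alpha.
Proof.
  assert (ha := t_arc_enclosure alpha halpha).
  replace 2 with (1 + 1) at 1 by ring; rewrite sigma_second_turn2 by lra; unfold rho2.
  replace (- ((k + 1) * 1)) with (- k + - (1)) by ring; rewrite exp_plus, (exp_Ropp 1).
  assert (he := exp_1_enclosure); assert (h3 := exp_t_arc_enclosure alpha halpha).
  assert (hk := rate_enclosure alpha halpha).
  field; lra.
Qed.

(** ** The increment over one period *)

(** The derivative of [sigma]; as an average of [growth] over the preceding
    period it is controlled by its values on a single period. *)
Definition growth (t : R) : R := sigma t - rho (t - 1).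

Lemma growth_second_turn0 x :
  0 <= x < t2 -> growth (1 + x) = exp x * (lev0 alpha - A0 - A0 * x).
Proof.
  intros hx; unfold growth; replace (1 + x - 1) with x by ring.
  rewrite sigma_second_turn0, rho_piece0 by lra; ring.
Qed.

Lemma growth_second_turn1 x :
  t2 <= x <= t3 -> growth (1 + x) = exp x * (lev1 alpha - A1 - A1 * (x - t2)).
Proof.
  intros hx; unfold growth; replace (1 + x - 1) with x by ring.
  rewrite sigma_second_turn1, rho_piece1 by lra; ring.
Qed.

Lemma growth_second_turn2 x :
  t3 <= x < 1 ->
  growth (1 + x) = exp x * (lev2 alpha - A2 - tan alpha * ratio - A2 * (x - t3)
    + tan alpha * ratio * k * ((1 - exp (- ((k + 1) * (x - t3)))) / (k + 1))).
Proof.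
  intros hx; assert (hk := rate_enclosure alpha halpha).
  unfold growth; replace (1 + x - 1) with x by ring.
  rewrite sigma_second_turn2, rho_piece2 by lra.
  replace (- (k * x)) with (x + - ((k + 1) * x)) by ring.
  rewrite exp_plus, exp_decay_from_arc.
  set (E := exp (- ((k + 1) * (x - t3)))); set (q := ratio); clearbody E q.
  field; lra.
Qed.

Lemma growth_sigma t : 2 <= t -> growth t = sigma t - sigma (t - 1).
Proof. intros h; unfold growth; rewrite (sigma_rho (t - 1)) by lra; reflexivity. Qed.

Lemma growth_derive t :
  2 < t -> t <> 2 + t2 -> t <> 3 -> is_derive growth t (growth t - growth (t - 1)).
Proof.
  intros h h1 h2; assert (hj := t_jump_enclosure alpha halpha).
  apply (is_derive_ext_loc (fun t => sigma t - sigma (t - 1))).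
  - apply (locally_above 2); [easy|]; intros; symmetry; apply growth_sigma; lra.
  - apply (is_derive_minus sigma (fun t => sigma (t - 1))).
    + apply sigma_derive; lra.
    + evar_last.
      * apply (is_derive_comp sigma (fun t => t - 1)); [apply sigma_derive; lra|].
        instantiate (1 := 1); auto_derive; [easy | ring].
      * apply Rmult_1_l.
Qed.

Lemma growth_ext_continuous t : 2 <= t -> continuous (fun t => sigma t - sigma (t - 1)) t.
Proof.
  intros h; apply (continuous_minus sigma (fun t => sigma (t - 1))).
  - apply sigma_continuous; lra.
  - apply (continuous_comp (fun t => t - 1) sigma); [|apply sigma_continuous; lra].
    apply (ex_derive_continuous (fun t => t - 1)); auto_derive; easy.
Qed.

Lemma growth_ext_derive t :
  2 < t -> t <> 2 + t2 -> t <> 3 ->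
  is_derive (fun t => sigma t - sigma (t - 1)) t (growth t - growth (t - 1)).
Proof.
  intros h h1 h2; apply (is_derive_ext_loc growth); [|now apply growth_derive].
  apply (locally_above 2); [easy|]; intros; apply growth_sigma; lra.
Qed.

Lemma growth_third_turn0 x :
  0 <= x <= t2 ->
  growth (2 + x) = exp x * (rho2 alpha - lev0 alpha - (lev0 alpha - A0) * x + A0 * (x * x) / 2).
Proof.
  intros hx; assert (hj := t_jump_enclosure alpha halpha); rewrite growth_sigma by lra.
  set (S := fun t => exp (t - 2) * (rho2 alpha - lev0 alpha - (lev0 alpha - A0) * (t - 2)
    + A0 * ((t - 2) * (t - 2)) / 2)).
  transitivity (S (2 + x)); [|unfold S; replace (2 + x - 2) with x by ring; reflexivity].
  apply (linear_uniqueness 1 (fun t => sigma t - sigma (t - 1)) (fun t => growth t - growth (t - 1))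
    S (fun t => S t + exp (t - 2) * (A0 * (t - 2) - (lev0 alpha - A0))) 2 (2 + x)).
  - lra.
  - intros t ht; apply growth_ext_derive; lra.
  - intros t ht; unfold S; auto_derive; [easy | unfold Rminus; field].
  - intros t ht; apply growth_ext_continuous; lra.
  - intros t ht; apply (ex_derive_continuous S); unfold S; auto_derive; easy.
  - intros t ht; replace (t - 1) with (1 + (t - 2)) at 1 by ring.
    rewrite growth_second_turn0, growth_sigma by lra; ring.
  - replace (2 - 1) with 1 by ring; rewrite sigma_2, (sigma_rho 1), rho_1 by lra.
    unfold S; rewrite Rminus_diag, exp_0; field.
Qed.

Lemma growth_third_turn1 x :
  t2 <= x <= t3 ->
  growth (2 + x) = exp x * (growth1 alpha - (lev1 alpha - A1) * (x - t2)
    + A1 * ((x - t2) * (x - t2)) / 2).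
Proof.
  intros hx; assert (hj := t_jump_enclosure alpha halpha); assert (ha := t_arc_enclosure alpha halpha).
  rewrite growth_sigma by lra.
  set (S := fun t => exp (t - 2) * (growth1 alpha - (lev1 alpha - A1) * (t - 2 - t2)
    + A1 * ((t - 2 - t2) * (t - 2 - t2)) / 2)).
  transitivity (S (2 + x)); [|unfold S; replace (2 + x - 2) with x by ring; reflexivity].
  apply (linear_uniqueness 1 (fun t => sigma t - sigma (t - 1)) (fun t => growth t - growth (t - 1))
    S (fun t => S t + exp (t - 2) * (A1 * (t - 2 - t2) - (lev1 alpha - A1))) (2 + t2) (2 + x)).
  - lra.
  - intros t ht; apply growth_ext_derive; lra.
  - intros t ht; unfold S; auto_derive; [easy | unfold Rminus; field].
  - intros t ht; apply growth_ext_continuous; lra.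
  - intros t ht; apply (ex_derive_continuous S); unfold S; auto_derive; easy.
  - intros t ht; replace (t - 1) with (1 + (t - 2)) at 1 by ring.
    rewrite growth_second_turn1, growth_sigma by lra; ring.
  - rewrite <- growth_sigma, growth_third_turn0 by lra.
    unfold S, growth1; replace (2 + t2 - 2) with t2 by ring; field.
Qed.

Lemma growth_lower_third_turn0 x : 0 <= x <= t2 -> 0.4433 <= growth (2 + x).
Proof.
  intros hx; rewrite growth_third_turn0 by easy.
  assert (hj := t_jump_enclosure alpha halpha); assert (b1 := slope2_enclosure alpha halpha).
  assert (b2 := growth_slope0_enclosure alpha halpha); assert (b3 := amp0_enclosure alpha halpha).
  assert (he := exp_neg_upper4 x ltac:(lra)); assert (hp := exp_pos x).
  assert (hE : exp x * exp (- x) = 1) by (rewrite <- exp_plus, Rplus_opp_r; apply exp_0).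
  assert (H : 0.4433 * exp (- x) <= rho2 alpha - lev0 alpha - (lev0 alpha - A0) * x + A0 * (x * x) / 2).
  { apply Rle_trans with (0.47504 - 0.64952 * x + 0.541149 * (x * x)); [|nra].
    apply Rle_trans with (0.4433 * (1 - x + x ^ 2 / 2 - x ^ 3 / 6 + x ^ 4 / 24)); [lra|].
    (* The two sides almost touch near 0.285. *)
    assert (0 <= (x - 0.285) ^ 2 * (x + 0.57)) by (apply Rmult_le_pos; [apply pow2_ge_0 | lra]).
    assert (0 <= (x - 0.298) ^ 2) by apply pow2_ge_0.
    assert (0 <= x ^ 2 * ((0.466 - x) * (0.466 + x))) by (apply Rmult_le_pos; [apply pow2_ge_0 | nra]).
    lra. }
  nra.
Qed.

Lemma growth_lower_third_turn1 x : t2 <= x <= t3 -> 0.4433 <= growth (2 + x).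
Proof.
  intros hx; rewrite growth_third_turn1 by easy.
  assert (hj := t_jump_enclosure alpha halpha); assert (b0 := gap_enclosure alpha halpha).
  assert (b1 := growth1_enclosure alpha halpha); assert (b2 := growth_slope1_enclosure alpha halpha).
  assert (b3 := amp1_enclosure alpha halpha); assert (b4 := exp_t_jump_enclosure alpha halpha).
  set (y := x - t2) in *; replace x with (t2 + y) by (unfold y; ring); rewrite exp_plus.
  assert (hy : 0 <= y <= 0.211) by (unfold y; lra).
  assert (he : 1 + y + y * y / 2 <= exp y) by (apply exp_lower2; lra).
  assert (H : 0.28992 - 0.38272 * y + 0.422516 * (y * y)
    <= growth1 alpha - (lev1 alpha - A1) * y + A1 * (y * y) / 2) by nra.
  assert (hq : 0 <= 0.28992 - 0.38272 * y + 0.422516 * (y * y)) by nra.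
  apply Rle_trans with ((1.59318 * (1 + y + y * y / 2)) * (0.28992 - 0.38272 * y + 0.422516 * (y * y))).
  - assert (h3 : 0 <= y ^ 3) by (apply pow_le; lra); nra.
  - apply Rmult_le_compat; [nra | easy | | easy].
    apply Rmult_le_compat; nra.
Qed.

(** The exact formula contains one more exponential than on the other pieces; it
    is replaced by Taylor polynomials of degree 3 and 4. *)
Lemma growth_bounds_second_turn2 x : t3 <= x < 1 -> 0.4 <= growth (1 + x) <= 0.46.
Proof.
  intros hx; rewrite growth_second_turn2 by easy.
  assert (ha := t_arc_enclosure alpha halpha); assert (hk := rate_enclosure alpha halpha).
  assert (b1 := lev2_enclosure alpha halpha); assert (b2 := amp2_enclosure alpha halpha).
  assert (b3 := tan_decay_arc_enclosure alpha halpha); assert (b4 := exp_t_arc_enclosure alpha halpha).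
  set (z := x - t3) in *; replace x with (t3 + z) by (unfold z; ring); rewrite exp_plus.
  assert (hz : 0 <= z <= 0.32375) by (unfold z; lra).
  set (w := tan alpha * ratio) in *.
  assert (b5 : 0.62481 <= w * k <= 0.62485).
  { generalize (mult_enclosure b3 hk ltac:(lra) ltac:(lra)); lra. }
  set (y := (k + 1) * z).
  assert (hy : 0 <= y) by (unfold y; nra).
  assert (u3 := exp_neg_lower3 y hy); assert (u4 := exp_neg_upper4 y hy).
  set (F := (1 - exp (- y)) / (k + 1)).
  assert (hF : F * (k + 1) = 1 - exp (- y)) by (unfold F; field; lra).
  set (n := k + 1) in *; assert (hn : 3.08883 <= n <= 3.08886) by (unfold n; lra).
  assert (hz2 : 0 <= z ^ 2) by (apply pow_le; lra).
  assert (hz3 : 0 <= z ^ 3) by (apply pow_le; lra).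
  assert (hz4 : 0 <= z ^ 4) by (apply pow_le; lra).
  assert (hn2 : 9.54087 <= n ^ 2 <= 9.54106).
  { replace (n ^ 2) with (n * n) by ring.
    generalize (mult_enclosure hn hn ltac:(lra) ltac:(lra)); lra. }
  assert (hn3 : 29.4701 <= n ^ 3 <= 29.471).
  { replace (n ^ 3) with (n * n ^ 2) by ring.
    generalize (mult_enclosure hn hn2 ltac:(lra) ltac:(lra)); lra. }
  assert (m2 := mult_enclosure hn (conj (Rle_refl _) (Rle_refl _)) ltac:(lra) hz2).
  assert (m3 := mult_enclosure hn2 (conj (Rle_refl _) (Rle_refl _)) ltac:(lra) hz3).
  assert (m4 := mult_enclosure hn3 (conj (Rle_refl _) (Rle_refl _)) ltac:(lra) hz4).
  replace y with (n * z) in * by reflexivity.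
  assert (F1 : F <= z - 1.544415 * z ^ 2 + 1.59018 * z ^ 3).
  { apply Rle_trans with (z - n * z ^ 2 / 2 + n ^ 2 * z ^ 3 / 6); [|lra].
    apply Rmult_le_reg_r with n; [lra|]; rewrite hF; lra. }
  assert (F2 : z - 1.54443 * z ^ 2 + 1.590145 * z ^ 3 - 1.22796 * z ^ 4 <= F).
  { apply Rle_trans with (z - n * z ^ 2 / 2 + n ^ 2 * z ^ 3 / 6 - n ^ 3 * z ^ 4 / 24); [lra|].
    apply Rmult_le_reg_r with n; [lra|]; rewrite hF; lra. }
  assert (hF0 : 0 <= F).
  { apply Rmult_le_reg_r with n; [lra|]; rewrite hF, Rmult_0_l.
    assert (exp (- (n * z)) <= 1); [|lra].
    rewrite <- exp_0; destruct hy as [hy|<-]; [left; apply exp_increasing; lra | rewrite Ropp_0; lra]. }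
  set (v := w * k) in *.
  set (B := lev2 alpha - A2 - w - A2 * z + v * F).
  assert (hv : 0 <= v) by lra.
  assert (c1 := mult_enclosure b5 (conj (Rle_refl _) (Rle_refl _)) ltac:(lra) (proj1 hz)).
  assert (c2 := mult_enclosure b5 (conj (Rle_refl _) (Rle_refl _)) ltac:(lra) hz2).
  assert (c3 := mult_enclosure b5 (conj (Rle_refl _) (Rle_refl _)) ltac:(lra) hz3).
  assert (c4 := mult_enclosure b5 (conj (Rle_refl _) (Rle_refl _)) ltac:(lra) hz4).
  assert (c5 := mult_enclosure b2 (conj (Rle_refl _) (Rle_refl _)) ltac:(lra) (proj1 hz)).
  assert (B1 : B <= 0.20484 + 0.07895 * z - 0.96496 * z ^ 2 + 0.99363 * z ^ 3).
  { generalize (Rmult_le_compat_l v _ _ hv F1); unfold B; lra. }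
  assert (B2 : 0.20476 + 0.07889 * z - 0.96504 * z ^ 2 + 0.99353 * z ^ 3 - 0.7673 * z ^ 4 <= B).
  { generalize (Rmult_le_compat_l v _ _ hv F2); unfold B; lra. }
  assert (hp := exp_pos z); assert (hp' := exp_pos (- z)).
  assert (hE : exp z * exp (- z) = 1) by (rewrite <- exp_plus, Rplus_opp_r; apply exp_0).
  assert (v2 := exp_neg_upper2 z ltac:(lra)); assert (v3 := exp_neg_lower3 z ltac:(lra)).
  assert (L' : 0.4 * exp (- z) <= 1.96649 * B).
  { assert (0 <= z * (z - 0.32375) ^ 2) by (apply Rmult_le_pos; [lra | apply pow2_ge_0]).
    assert (0 <= z * (0.32375 - z)) by (apply Rmult_le_pos; lra).
    assert (0 <= z ^ 3 * (0.32375 - z)) by (apply Rmult_le_pos; lra).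
    lra. }
  assert (hB : 0 <= B) by lra.
  assert (c6 := mult_enclosure b4 (conj (Rle_refl B) (Rle_refl B)) ltac:(lra) hB).
  assert (U : exp t3 * B <= 0.46 * exp (- z)).
  { (* The two sides almost touch near 0.2. *)
    assert (0 <= (z - 0.2) ^ 2 * (0.324 - z)) by (apply Rmult_le_pos; [apply pow2_ge_0 | lra]).
    assert (0 <= (z - 0.206) ^ 2) by apply pow2_ge_0.
    lra. }
  assert (L : 0.4 * exp (- z) <= exp t3 * B) by lra.
  clear - U L hE hp; split; nra.
Qed.

Lemma growth_at_arc : 0.4485 <= growth (2 + t3).
Proof.
  assert (hj := t_jump_enclosure alpha halpha); assert (b0 := gap_enclosure alpha halpha).
  rewrite growth_third_turn1 by lra.
  generalize (mult_enclosure (exp_t_arc_enclosure alpha halpha) (growth2_enclosure alpha halpha)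
    ltac:(lra) ltac:(lra)).
  unfold growth2; lra.
Qed.

(** Here [growth' t = growth t - growth (t - 1) >= growth t - 0.46], so that
    [growth] stays above the solution of [g' = g - 0.46] that starts at 0.4485. *)
Lemma growth_lower_third_turn2 x : t3 <= x <= 1 -> 0.4433 <= growth (2 + x).
Proof.
  intros hx; assert (hj := t_jump_enclosure alpha halpha); assert (ha := t_arc_enclosure alpha halpha).
  rewrite growth_sigma by lra.
  set (S := fun t => 0.46 - 0.0115 * exp (t - 2 - t3)).
  apply Rle_trans with (S (2 + x)).
  - unfold S; replace (2 + x - 2 - t3) with (x - t3) by ring.
    assert (he : exp (x - t3) <= / 0.71).
    { rewrite <- (Rinv_inv (exp (x - t3))), <- exp_Ropp.
      apply Rinv_le_contravar; [lra|].
      assert (hz : 0 <= x - t3 <= 0.32375) by lra.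
      generalize (exp_neg_lower3 _ (proj1 hz)); set (z := x - t3) in *; intros h.
      assert (0 <= z ^ 3 <= 0.105 * z).
      { split; [apply pow_le; lra|]. simpl; nra. }
      nra. }
    lra.
  - apply (linear_comparison 1 (fun t => sigma t - sigma (t - 1)) (fun t => growth t - growth (t - 1))
      S (fun t => - 0.0115 * exp (t - 2 - t3)) (2 + t3) (2 + x)).
    + lra.
    + intros t ht; apply growth_ext_derive; lra.
    + intros t ht; unfold S; auto_derive; [easy | unfold Rminus; lra].
    + intros t ht; apply growth_ext_continuous; lra.
    + intros t ht; apply (ex_derive_continuous S); unfold S; auto_derive; easy.
    + intros t ht; rewrite growth_sigma by lra; replace (t - 1) with (1 + (t - 2)) by ring.
      generalize (growth_bounds_second_turn2 (t - 2) ltac:(lra)); unfold S; lra.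
    + rewrite <- growth_sigma by lra; generalize growth_at_arc; unfold S.
      replace (2 + t3 - 2 - t3) with 0 by ring; rewrite exp_0; lra.
Qed.

Lemma sigma_increase m a b :
  2 <= a -> a <= b -> (forall t, a < t < b -> m <= growth t) -> m * (b - a) <= sigma b - sigma a.
Proof.
  intros ha hab hm.
  assert (hj := t_jump_enclosure alpha halpha).
  assert (H : sigma a - m * a <= sigma b - m * b); [|lra].
  apply (le_of_derive_nonneg (fun t => sigma t - m * t) (fun t => growth t - m)); [easy | | |].
  - intros t ht; apply (is_derive_minus sigma (fun t => m * t)).
    + apply sigma_derive; lra.
    + auto_derive; [easy | ring].
  - intros t ht; apply (continuous_minus sigma (fun t => m * t)); [apply sigma_continuous; lra|].
    apply (ex_derive_continuous (fun t => m * t)); auto_derive; easy.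
  - intros t ht; generalize (hm t ht); lra.
Qed.

(** [growth t] is the mean of [growth] over [t - 1, t], so it cannot drop below a
    bound that holds over a whole period: at a minimum on a window of length
    1/2, at least half of the mean comes from earlier values. *)
Lemma growth_lower_propagates m :
  (forall t, 2 <= t <= 3 -> m <= growth t) -> forall t, 2 <= t -> m <= growth t.
Proof.
  intros h0.
  assert (H : forall n : nat, forall t, 2 <= t <= 3 + INR n / 2 -> m <= growth t).
  { induction n as [|n IH]; intros t ht; [apply h0; simpl in ht; lra|].
    rewrite S_INR in ht; assert (hn := pos_INR n); set (a := 3 + INR n / 2) in *.
    assert (ha : 3 <= a) by (unfold a; lra).
    destruct (Rle_dec t a) as [hta|hta]; [apply IH; lra|].
    destruct (continuity_ab_min (fun t => sigma t - sigma (t - 1)) a (a + 1 / 2)) as [s [hmin hs]].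
    - lra.
    - intros c hc; apply continuity_pt_filterlim, growth_ext_continuous; lra.
    - apply Rle_trans with (growth s).
      2: { rewrite !growth_sigma by lra; apply hmin; unfold a in *; lra. }
      apply Rnot_lt_le; intros hlt.
      assert (e1 : growth s * (s - a) <= sigma s - sigma a).
      { apply sigma_increase; [lra | lra |]; intros u hu.
        rewrite !growth_sigma by lra; apply hmin; lra. }
      assert (e2 : m * (a - (s - 1)) <= sigma a - sigma (s - 1)).
      { apply sigma_increase; [lra | lra |]; intros u hu; apply IH; lra. }
      assert (e3 := growth_sigma s ltac:(lra)).
      nra. }
  intros t ht; destruct (nfloor_ex (2 * t)) as [n hn]; [lra|].
  apply (H (S n)); rewrite S_INR; lra.
Qed.

Lemma growth_lower t : 2 <= t -> 0.4433 <= growth t.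
Proof.
  apply growth_lower_propagates; clear t; intros t ht.
  replace t with (2 + (t - 2)) by ring.
  destruct (Rle_dec (t - 2) t2); [apply growth_lower_third_turn0; lra|].
  destruct (Rle_dec (t - 2) t3); [apply growth_lower_third_turn1; lra|].
  apply growth_lower_third_turn2; lra.
Qed.

(** By conservation [growth t - drift] is the integral of [growth] over the last
    period with weights decreasing linearly from 1 to 0, hence at least half of
    the lower bound 0.4433. *)
Lemma growth_lower_late t : 3 <= t -> 0.447 <= growth t.
Proof.
  intros ht; set (m := 0.4433).
  assert (hD := rho_drift t ltac:(lra)); assert (hd := drift_enclosure alpha halpha).
  set (s := sigma (t - 1)).
  assert (hI : is_RInt (fun u => s + m * (u - t + 1)) (t - 1) t (s + m / 2)).
  { evar_last.
    - apply (is_RInt_derive (fun u => s * u + m * (u - t + 1) ^ 2 / 2)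
        (fun u => s + m * (u - t + 1))).
      + intros u _; auto_derive; [easy | unfold Rminus; field].
      + intros u _; apply (ex_derive_continuous (fun u => s + m * (u - t + 1))); auto_derive; easy.
    - change (s * t + m * (t - t + 1) ^ 2 / 2 - (s * (t - 1) + m * (t - 1 - t + 1) ^ 2 / 2)
        = s + m / 2); field. }
  assert (hle : s + m / 2 <= RInt rho (t - 1) t).
  { rewrite <- (is_RInt_unique _ _ _ _ hI).
    apply RInt_le; [lra | eexists; exact hI | apply ex_RInt_rho; lra |].
    intros u hu; rewrite <- sigma_rho by lra.
    assert (h := sigma_increase m (t - 1) u ltac:(lra) ltac:(lra)
      ltac:(intros v hv; apply growth_lower; lra)).
    unfold s; lra. }
  rewrite growth_sigma by lra; unfold s, m in *; lra.
Qed.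

(** ** The gain of the ray over the length *)

Definition gain (t : R) : R := rho t - 2.08 * ell t.

Lemma gain_sigma t : 1 <= t -> gain t = sigma t - 2.08 * ell t.
Proof. intros h; unfold gain; rewrite sigma_rho by easy; reflexivity. Qed.

(** The gain satisfies [gain' = - k * gain + 3.08 * growth + (k - 2.08) * sigma],
    with a positive last term as the slope 2.08 is slightly below [k]. *)
Lemma gain_decay a b E :
  1 < a -> a <= b ->
  (forall t, a < t < b -> t <> 1 + t2 /\ t <> 2) ->
  (forall t, a < t < b -> k * E <= 3.08 * growth t + (k - 2.08) * sigma t) ->
  E + (gain a - E) * exp (- (k * (b - a))) <= gain b.
Proof.
  intros ha hab hne hE; rewrite !gain_sigma by lra.
  set (G := fun t => sigma t - 2.08 * ell t); fold (G a) (G b).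
  set (S := fun t => E + (G a - E) * exp (- (k * (t - a)))); fold (S b).
  apply (linear_comparison (- k) G
    (fun t => sigma t - rho (t - 1) - 2.08 * (rho (t - 1) - k * ell t))
    S (fun t => - k * (S t - E)) a b); [easy | | | | | |].
  - intros t ht; destruct (hne t ht).
    apply (is_derive_minus sigma (fun t => 2.08 * ell t)); [apply sigma_derive; lra|].
    apply (is_derive_scal ell), ell_derive; lra.
  - intros t ht; unfold S; auto_derive; [easy | unfold Rminus; ring].
  - intros t ht; apply (continuous_minus sigma (fun t => 2.08 * ell t)).
    + apply sigma_continuous; lra.
    + apply (continuous_scal_r 2.08 ell), ell_continuous; lra.
  - intros t ht; apply (ex_derive_continuous S); unfold S; auto_derive; easy.
  - intros t ht; generalize (hE t ht); unfold growth, G; lra.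
  - unfold S; rewrite Rminus_diag, Rmult_0_r, Ropp_0, exp_0; lra.
Qed.

Lemma inv_rate_succ : 0.67338 <= 2.08 / (k + 1) <= 0.673395.
Proof.
  assert (hk : 3.08883 <= k + 1 <= 3.08886) by (generalize (rate_enclosure alpha halpha); lra).
  assert (h2 : 2.08 <= 2.08 <= 2.08) by lra.
  generalize (div_enclosure h2 hk ltac:(lra) ltac:(lra)); lra.
Qed.

Lemma gain_second_turn0 x : 0 <= x < t2 -> 0.67 <= gain (1 + x).
Proof.
  intros hx; assert (hj := t_jump_enclosure alpha halpha).
  rewrite gain_sigma, sigma_second_turn0, ell_piece0 by lra.
  assert (c := inv_rate_succ); assert (b1 := lev0_enclosure alpha halpha).
  assert (b2 := amp0_enclosure alpha halpha).
  replace (exp x * (lev0 alpha - A0 * x) - 2.08 * (A0 * exp x / (k + 1)))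
    with (exp x * (lev0 alpha - A0 * x - 2.08 / (k + 1) * A0)) by (unfold Rdiv; ring).
  assert (h1 := mult_enclosure c b2 ltac:(lra) ltac:(lra)).
  assert (he := exp_ineq1_le x).
  apply Rle_trans with ((1 + x) * (1.0029 - 1.0824 * x)); [nra|].
  apply Rmult_le_compat; [lra | lra | lra | nra].
Qed.

Lemma gain_second_turn1 x : t2 <= x <= t3 -> 0.67 <= gain (1 + x).
Proof.
  intros hx; assert (hj := t_jump_enclosure alpha halpha).
  assert (hgap := gap_enclosure alpha halpha); assert (hk := rate_enclosure alpha halpha).
  rewrite gain_sigma, sigma_second_turn1, ell_piece1 by lra.
  assert (c := inv_rate_succ); assert (b1 := lev1_enclosure alpha halpha).
  assert (b2 := amp1_enclosure alpha halpha); assert (b3 := exp_t_jump_enclosure alpha halpha).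
  assert (b4 := decay_jump_enclosure alpha halpha).
  set (y := x - t2) in *.
  replace (exp x * (lev1 alpha - A1 * y) - 2.08 * ((A1 * exp x + exp (- (k * x))) / (k + 1)))
    with (exp x * (lev1 alpha - A1 * y - 2.08 / (k + 1) * A1) - 2.08 / (k + 1) * exp (- (k * x)))
    by (unfold Rdiv; ring).
  assert (hy : 0 <= y <= 0.21053) by (unfold y; lra).
  assert (he : exp (- (k * x)) <= exp (- (k * t2))).
  { destruct (Req_dec x t2) as [->|hne]; [lra|]; left; apply exp_increasing; nra. }
  assert (h0 : 0 < exp (- (k * x))) by apply exp_pos.
  assert (h1 := mult_enclosure c b2 ltac:(lra) ltac:(lra)).
  assert (hd : 2.08 / (k + 1) * exp (- (k * x)) <= 0.25455).
  { apply Rle_trans with (0.673395 * 0.37800889); [apply Rmult_le_compat; lra | lra]. }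
  assert (hQ : 0.6586 - 0.84504 * y <= lev1 alpha - A1 * y - 2.08 / (k + 1) * A1).
  { assert (A1 * y <= 0.84504 * y) by (apply Rmult_le_compat_r; lra); lra. }
  replace x with (t2 + y) at 1 by (unfold y; ring); rewrite exp_plus.
  assert (hey := exp_ineq1_le y).
  assert (h3 : 1.59318 * (1 + y) * (0.6586 - 0.84504 * y)
    <= exp t2 * exp y * (lev1 alpha - A1 * y - 2.08 / (k + 1) * A1)).
  { apply Rmult_le_compat; [lra | lra | | easy]; apply Rmult_le_compat; lra. }
  assert (0 <= y * (0.21053 - y)) by (apply Rmult_le_pos; lra).
  lra.
Qed.

Lemma gain_at_arc : 0.78 <= gain (1 + t3).
Proof.
  assert (hj := t_jump_enclosure alpha halpha); assert (hgap := gap_enclosure alpha halpha).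
  rewrite gain_sigma, sigma_second_turn1, ell_piece1 by lra.
  change (0.78 <= exp t3 * lev2 alpha - 2.08 * ((A1 * exp t3 + exp (- (k * t3))) / (k + 1))).
  assert (c := inv_rate_succ).
  assert (b1 := exp_t_arc_enclosure alpha halpha); assert (b2 := amp1_enclosure alpha halpha).
  assert (b3 := lev2_enclosure alpha halpha); assert (b4 := decay_arc_enclosure alpha halpha).
  assert (h1 := mult_enclosure b1 b3 ltac:(lra) ltac:(lra)).
  assert (h2 := mult_enclosure b2 b1 ltac:(lra) ltac:(lra)).
  assert (h3 : 0 <= A1 * exp t3 + exp (- (k * t3)) <= 1.90531) by lra.
  assert (h4 := mult_enclosure c h3 ltac:(lra) ltac:(lra)).
  replace (2.08 * ((A1 * exp t3 + exp (- (k * t3))) / (k + 1)))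
    with (2.08 / (k + 1) * (A1 * exp t3 + exp (- (k * t3)))) by (unfold Rdiv; ring).
  lra.
Qed.

Lemma rho_lower_after_arc t : t3 <= t < 1 -> 1.6 <= rho t.
Proof.
  intros ht; rewrite rho_piece2 by easy.
  assert (ha := t_arc_enclosure alpha halpha); assert (hk := rate_enclosure alpha halpha).
  assert (b1 := exp_t_arc_enclosure alpha halpha); assert (b2 := amp2_enclosure alpha halpha).
  assert (b3 := tan_enclosure alpha halpha); assert (b4 := decay_arc_enclosure alpha halpha).
  set (z := t - t3); replace t with (t3 + z) by (unfold z; ring).
  replace (- (k * (t3 + z))) with (- (k * t3) + - (k * z)) by ring; rewrite !exp_plus.
  assert (hz : 0 <= z <= 0.324) by (unfold z; lra).
  assert (h1 := mult_enclosure b2 b1 ltac:(lra) ltac:(lra)).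
  assert (h2 := mult_enclosure b3 b4 ltac:(lra) ltac:(lra)).
  assert (e1 := exp_ineq1_le z); assert (e2 := exp_ineq1_le (- (k * z))).
  assert (hkz : k * z <= 2.089 * z) by (apply Rmult_le_compat_r; lra).
  assert (h3 : 1.0735 * (1 + z) <= A2 * exp t3 * exp z) by (apply Rmult_le_compat; lra).
  assert (h4 : 0.5882 * (1 - 2.089 * z) <= tan alpha * exp (- (k * t3)) * exp (- (k * z)))
    by (apply Rmult_le_compat; lra).
  lra.
Qed.

(** The constant 0.5897 is just below [3.08 * 0.4 / k], the equilibrium of [gain]
    for the lower bound 0.4 of [growth]. *)
Lemma gain_second_turn2 x : t3 <= x <= 1 -> 0.67 <= gain (1 + x).
Proof.
  intros hx; assert (ha := t_arc_enclosure alpha halpha); assert (hj := t_jump_enclosure alpha halpha).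
  assert (hk := rate_enclosure alpha halpha).
  assert (H : 0.5897 + (gain (1 + t3) - 0.5897) * exp (- (k * (1 + x - (1 + t3)))) <= gain (1 + x)).
  { apply gain_decay; try lra.
    - intros; lra.
    - intros t ht; replace t with (1 + (t - 1)) by ring.
      assert (h1 := growth_bounds_second_turn2 (t - 1) ltac:(lra)).
      assert (h2 := rho_lower_after_arc (t - 1) ltac:(lra)).
      unfold growth in *; replace (1 + (t - 1) - 1) with (t - 1) in * by ring.
      assert (0 <= (k - 2.08) * sigma (1 + (t - 1))) by (apply Rmult_le_pos; lra).
      lra. }
  assert (hg := gain_at_arc).
  set (y := k * (1 + x - (1 + t3))) in *.
  assert (hy : 0 <= y <= 0.6763).
  { unfold y; split; [apply Rmult_le_pos; lra|].
    apply Rle_trans with (2.0889 * 0.32375); [apply Rmult_le_compat; lra | lra]. }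
  assert (he : 0.47 <= exp (- y)).
  { apply Rle_trans with (2 := exp_neg_lower3 y (proj1 hy)).
    assert (y ^ 3 <= 0.458 * y) by (simpl; nra).
    assert (0 <= (y - 0.6763) ^ 2) by apply pow2_ge_0. lra. }
  assert (0.19 * 0.47 <= (gain (1 + t3) - 0.5897) * exp (- y)) by (apply Rmult_le_compat; lra).
  lra.
Qed.

Lemma gain_2 : 0.7213 <= gain 2.
Proof.
  rewrite gain_sigma, sigma_2, ell_2 by lra.
  assert (c := inv_rate_succ); assert (b1 := rho2_enclosure alpha halpha).
  assert (b2 := lev0_enclosure alpha halpha); assert (b3 := decay_one_enclosure alpha halpha).
  assert (h1 : 3.8295 <= 1 + cot alpha + tan alpha <= 3.82961)
    by (generalize (cot_enclosure alpha halpha) (tan_enclosure alpha halpha); lra).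
  assert (h2 := mult_enclosure b3 h1 ltac:(lra) ltac:(lra)).
  assert (h3 : 0 <= lev0 alpha + exp (- k) * (1 + cot alpha + tan alpha) <= 2.20604) by lra.
  assert (h4 := mult_enclosure c h3 ltac:(lra) ltac:(lra)).
  replace (2.08 * ((lev0 alpha + exp (- k) * (1 + cot alpha + tan alpha)) / (k + 1)))
    with (2.08 / (k + 1) * (lev0 alpha + exp (- k) * (1 + cot alpha + tan alpha)))
    by (unfold Rdiv; ring).
  lra.
Qed.

Lemma sigma_lower a t : 2 <= a -> a <= t -> rho2 alpha + 0.4433 * (a - 2) <= sigma t.
Proof.
  intros ha ht; rewrite <- sigma_2.
  generalize (sigma_increase 0.4433 2 t ltac:(lra) ltac:(lra)
    ltac:(intros u hu; apply growth_lower; lra)); lra.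
Qed.

Lemma half_period_decay : 0.3518 <= exp (- (k * (1 / 2))).
Proof.
  assert (h := decay_one_enclosure alpha halpha).
  replace (- k) with (- (k * (1 / 2)) + - (k * (1 / 2))) in h by field.
  rewrite exp_plus in h; assert (hp := exp_pos (- (k * (1 / 2)))); nra.
Qed.

(** [E] is a lower bound of the equilibrium of [gain] when [growth >= m] and
    [sigma >= s]; over half a period the excess over [E] is multiplied by
    at least 0.3518. *)
Lemma gain_half_period a E m s t :
  2 <= a -> a <= t <= a + 1 / 2 -> E <= gain a -> k * E <= 3.08 * m + (k - 2.08) * s -> 
  (forall u, a < u -> m <= growth u) -> (forall u, a < u -> s <= sigma u) ->
  E + (gain a - E) * 0.3518 <= gain t.
Proof.
  intros ha ht hE hk hm hs; assert (hr' := rate_enclosure alpha halpha).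
  assert (hj := t_jump_enclosure alpha halpha).
  apply Rle_trans with (E + (gain a - E) * exp (- (k * (t - a)))).
  - apply Rplus_le_compat_l, Rmult_le_compat_l; [lra|].
    apply Rle_trans with (1 := half_period_decay).
    destruct (Req_dec (t - a) (1 / 2)) as [-> | hne]; [lra|]; left; apply exp_increasing; nra.
  - apply gain_decay; [lra | lra | intros; lra |]; intros u hu.
    apply Rle_trans with (1 := hk); apply Rplus_le_compat.
    + generalize (hm u ltac:(lra)); lra.
    + apply Rmult_le_compat_l; [lra | apply hs; lra].
Qed.

(** With 0.4433 as lower bound of [growth] the equilibrium stays below 0.67, but
    the surplus at [t = 2] lasts for one period.  The second half period uses
    that [sigma] has grown. *)
Lemma gain_third_turn t : 2 <= t <= 3 -> 0.67 <= gain t.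
Proof.
  intros ht; assert (hk := rate_enclosure alpha halpha); assert (b := rho2_enclosure alpha halpha).
  assert (g2 := gain_2).
  assert (H : forall u, 2 <= u <= 2 + 1 / 2 -> 0.6834 <= gain u).
  { intros u hu.
    generalize (gain_half_period 2 0.6629 0.4433 2.2 u ltac:(lra) hu ltac:(lra) ltac:(lra)
      ltac:(intros v hv; apply growth_lower; lra)
      ltac:(intros v hv; generalize (sigma_lower 2 v ltac:(lra) ltac:(lra)); lra)); lra. }
  destruct (Rle_dec t (2 + 1 / 2)) as [h|h]; [generalize (H t ltac:(lra)); lra|].
  assert (g' := H (2 + 1 / 2) ltac:(lra)).
  generalize (gain_half_period (2 + 1 / 2) 0.6638 0.4433 2.42 t ltac:(lra) ltac:(lra) ltac:(lra) ltac:(lra)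
      ltac:(intros v hv; apply growth_lower; lra)
      ltac:(intros v hv; generalize (sigma_lower (2 + 1 / 2) v ltac:(lra) ltac:(lra)); lra)); lra.
Qed.

Lemma gain_late t : 3 <= t -> 0.67 <= gain t.
Proof.
  intros ht; assert (hk := rate_enclosure alpha halpha); assert (b := rho2_enclosure alpha halpha).
  assert (hj := t_jump_enclosure alpha halpha).
  assert (g3 := gain_third_turn 3 ltac:(lra)).
  assert (H : 0.67 + (gain 3 - 0.67) * exp (- (k * (t - 3))) <= gain t).
  { apply gain_decay; [lra | lra | intros; lra |]; intros u hu.
    assert (h1 := growth_lower_late u ltac:(lra)).
    assert (h2 := sigma_lower 3 u ltac:(lra) ltac:(lra)).
    assert ((k - 2.08) * 2.65 <= (k - 2.08) * sigma u) by (apply Rmult_le_compat_l; lra).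
    lra. }
  assert (0 <= (gain 3 - 0.67) * exp (- (k * (t - 3)))); [|lra].
  apply Rmult_le_pos; [lra | left; apply exp_pos].
Qed.

(** The margins are wide here, and crude bounds of the length suffice. *)
Lemma gain_first_turn t : 0 <= t < 1 -> 0.67 <= gain t.
Proof.
  intros ht; assert (hj := t_jump_enclosure alpha halpha); assert (ha := t_arc_enclosure alpha halpha).
  assert (hk := rate_enclosure alpha halpha); assert (hT := period_enclosure alpha halpha).
  assert (hal := alpha_enclosure alpha halpha); assert (hph := segment_end_enclosure alpha halpha).
  assert (htan := tan_enclosure alpha halpha); assert (hcot := cot_enclosure alpha halpha).
  (* Counting time from the jump at [2 * PI], the delayed angle is [T * u - alpha]. *)
  set (u := t - t2).
  assert (hy : phi0 + T * (t - 1) = T * u - alpha).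
  { unfold u; generalize t_jump_eq; unfold period; lra. }
  unfold gain, ell; rewrite hy.
  destruct (spiral_length_before (T * u - alpha)) as [L0 [L1 L2]]; [rewrite <- hy; nra|].
  destruct (Rle_dec (T * u - alpha) 0) as [h0|h0].
  { rewrite L0 by easy.
    assert (b0 := amp0_enclosure alpha halpha); assert (b1 := amp1_enclosure alpha halpha).
    assert (he := exp_ineq1_le t).
    assert (h1 : 1 * 1 <= A0 * exp t) by (apply Rmult_le_compat; lra).
    assert (h2 : 0.8 * 1 <= A1 * exp t) by (apply Rmult_le_compat; lra).
    destruct (Rlt_dec t t2); [rewrite rho_piece0; lra|].
    destruct (Rle_dec t t3); [rewrite rho_piece1; lra|].
    generalize (rho_lower_after_arc t ltac:(lra)); lra. }
  assert (hu : 0.1579 <= u) by (apply (Rmult_le_reg_l T); lra).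
  assert (hrho : 1.555 <= rho t).
  { destruct (Rle_dec t t3) as [h3|h3]; [|generalize (rho_lower_after_arc t ltac:(lra)); lra].
    rewrite rho_piece1 by (unfold u in *; lra).
    replace t with (t2 + u) by (unfold u; ring); rewrite exp_plus.
    assert (b1 := amp1_enclosure alpha halpha); assert (b2 := exp_t_jump_enclosure alpha halpha).
    assert (he := exp_ineq1_le u).
    assert (h1 := mult_enclosure b1 b2 ltac:(lra) ltac:(lra)).
    rewrite <- Rmult_assoc.
    apply Rle_trans with (1.3462 * 1.1579); [lra | apply Rmult_le_compat; lra]. }
  replace (- (k * t)) with (- (k * t2) + - (k * u)) by (unfold u; ring); rewrite exp_plus.
  assert (b3 := decay_jump_enclosure alpha halpha).
  (* A lower bound of [exp (k * u)]. *)
  set (p := 1 + 2.08883 * u + (2.08883 * u) * (2.08883 * u) / 2).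
  assert (hp : 1 <= p) by (unfold p; nra).
  assert (he : p <= exp (k * u)).
  { apply Rle_trans with (1 + k * u + k * u * (k * u) / 2);
      [|apply exp_lower2, Rmult_le_pos; lra].
    assert (2.08883 * u <= k * u) by (apply Rmult_le_compat_r; lra).
    unfold p; assert (2.08883 * u * (2.08883 * u) <= k * u * (k * u)) by (apply Rmult_le_compat; lra).
    lra. }
  assert (hd : exp (- (k * u)) <= / p) by (rewrite exp_Ropp; apply Rinv_le_contravar; lra).
  assert (hd0 := exp_pos (- (k * u))).
  assert (H : forall L c, 0 <= L -> 2.08 * 0.37801 * L <= c * p ->
      2.08 * (L * (exp (- (k * t2)) * exp (- (k * u)))) <= c).
  { intros L c hL hc; apply Rle_trans with (2.08 * (L * (0.37801 * / p))).
    - apply Rmult_le_compat_l, Rmult_le_compat_l; [lra | easy |]; apply Rmult_le_compat; lra.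
    - apply (Rmult_le_reg_r p); [lra|].
      replace (2.08 * (L * (0.37801 * / p)) * p) with (2.08 * 0.37801 * L) by (field; lra); easy. }
  destruct (Rle_dec (T * u - alpha) (tan alpha)) as [h1|h1].
  - rewrite L1 by lra.
    assert (hu' : u <= 0.482) by (apply (Rmult_le_reg_l T); lra).
    assert (hTu : T * u <= 7.4615 * u) by (apply Rmult_le_compat_r; lra).
    assert (hs : 0 <= (u - 0.482) ^ 2) by apply pow2_ge_0.
    assert (hc : 2.08 * 0.37801 * (T * u - alpha) <= 0.88 * p) by (unfold p; lra).
    generalize (H (T * u - alpha) 0.88 ltac:(lra) hc); lra.
  - assert (hu' : 0.4816 <= u) by (apply (Rmult_le_reg_l T); lra).
    assert (hr3 : 1.6 <= rho t) by (apply rho_lower_after_arc; unfold u in *; lra).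
    assert (hL := L2 ltac:(lra)).
    assert (hL' : spiral_length alpha r (T * u - alpha) * (exp (- (k * t2)) * exp (- (k * u)))
      <= 2.83 * (exp (- (k * t2)) * exp (- (k * u)))).
    { apply Rmult_le_compat_r; [apply Rmult_le_pos; lra | lra]. }
    assert (hs : 0 <= (u - 0.4816) ^ 2) by apply pow2_ge_0.
    assert (hc : 2.08 * 0.37801 * 2.83 <= 0.92 * p) by (unfold p; lra).
    generalize (H 2.83 0.92 ltac:(lra) hc); lra.
Qed.

Lemma gain_lower t : 0 <= t -> 0.67 <= gain t.
Proof.
  intros ht; assert (ha := t_arc_enclosure alpha halpha).
  destruct (Rlt_dec t 1); [apply gain_first_turn; lra|].
  destruct (Rle_dec 3 t); [now apply gain_late|].
  destruct (Rle_dec 2 t); [apply gain_third_turn; lra|].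
  replace t with (1 + (t - 1)) by ring.
  destruct (Rlt_dec (t - 1) t2); [apply gain_second_turn0; lra|].
  destruct (Rle_dec (t - 1) t3); [apply gain_second_turn1; lra|].
  apply gain_second_turn2; lra.
Qed.

End Ray.

Theorem proposition1p20 (alpha : R) (r : R -> R) (phi : R)
    (halpha : critical_angle alpha) (hr : ray_length alpha r)
    (hphi : tan alpha + PI / 2 - alpha <= phi) :
  r phi - 2.08 * spiral_length alpha r (phi - 2 * PI - alpha)
    >= 0.67 * exp (critical_exponent alpha * (phi - tan alpha - PI / 2 + alpha)).
Proof.
  assert (hT := period_pos alpha halpha).
  set (t := (phi - segment_end alpha) / period alpha).
  assert (ht : 0 <= t) by (apply Rdiv_le_0_compat; unfold segment_end; lra).
  assert (e1 : segment_end alpha + period alpha * t = phi) by (unfold t; field; lra).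
  assert (e2 : segment_end alpha + period alpha * (t - 1) = phi - 2 * PI - alpha).
  { transitivity (phi - period alpha); [lra | unfold period; ring]. }
  assert (e3 : critical_exponent alpha * (phi - tan alpha - PI / 2 + alpha) = rate alpha * t).
  { replace (phi - tan alpha - PI / 2 + alpha) with (period alpha * t)
      by (unfold segment_end in e1; lra).
    unfold critical_exponent, rate; fold (period alpha); field; lra. }
  assert (G := gain_lower alpha r halpha hr t ht).
  unfold gain, rho, ell in G; rewrite e1, e2, exp_Ropp in G.
  rewrite e3; assert (hp := exp_pos (rate alpha * t)); apply Rle_ge.
  apply (Rmult_le_compat_r (exp (rate alpha * t))) in G; [|lra].
  eapply Rle_trans; [exact G|]; right; field; lra.
Qed.
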